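(* Fix a monomial order on $F$. Let $g_1,\dots,g_{n-r}\in S$ be a homogeneous regular sequence of degrees $d_1,\dots,d_{n-r}$. Let $M\subsetneq F$ be the graded submodule generated by \[ \{g_ie_j: 1\le i\le n-r,\ 1\le j\le m\}\cup\{f_1,\dots,f_s\}, \] where the $f_i$ are homogeneous, $s\ge1$, and $D=\max_i\deg(f_i)\ge l$. Let $J=(x_1^{d_1},\dots,x_{n-r}^{d_{n-r}})\subseteq S$. If $Q$ is an $l$-standard cone decomposition of $N_M$, and $P$ is any $D$-exact cone decomposition of $N_{JF}$ with Macaulay constants $b_0,\dots,b_{n+1}$, then \[ 1+\deg(Q)\le\max\{b_1,\ d_1+\cdots+d_{n-r}+l-n+1\}. \] (When $P^+\neq\emptyset$, $b_1=1+\deg(P^+)$.)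
   Context: Standing notation. $S=\mathbb{K}[x_1,\dots,x_n]$ is standard graded, and $F=Se_1\oplus\cdots\oplus Se_m$ is a graded free module with $\deg(e_j)\ge0$ integers; $l=\max_j\deg(e_j)$. Monomials of $F$ are $x^\alpha e_j$ of degree $|\alpha|+\deg(e_j)$. For a submodule $M'\subseteq F$, $N_{M'}$ is the $\mathbb{K}$-span of the monomials of $F$ not in $\mathrm{in}_\prec(M')$. Since $JF$ is a monomial submodule, $N_{JF}$ is the span of the monomials not in $JF$. A regular sequence means each $g_i$ is a non-zerodivisor modulo $(g_1,\dots,g_{i-1})$ and $(g_1,\dots,g_{n-r})\ne S$. Cones. For a homogeneous $h\in F$ and $u\subseteq\{x_1,\dots,x_n\}$, the cone $C(h,u)=h\,\mathbb{K}[u]$ has degree $\deg h$ and dimension $|u|$. A cone decomposition of a subspace $T\subseteq F$ is a finite set $P$ of cones with $T=\bigoplus_{C\in P}C$; $\deg(P)=\max_{C\in P}\deg C$, and $P^+=\{C\in P:\dim C>0\}$. $P$ is $q$-standard if (1) no $C\in P^+$ has $\deg C<q$, and (2) for every $C\in P^+$ and every integer $d$ with $q\le d\le\deg C$ there is $C'\in P$ with $\deg C'=d$ and $\dim C'\ge\dim C$. $P$ is $q$-exact if it is $q$-standard and distinct cones of $P^+$ have distinct degrees. The Macaulay constants of a $q$-exact $P$ are $b_k=\max(\{q\}\cup\{1+\deg C: C\in P,\ \dim C\ge k\})$ for $k=0,\dots,n+1$. *)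

(* Defs.v *)
From HB Require Import structures.
From mathcomp Require Import all_boot all_order all_algebra.
From mathcomp Require Import mpoly.
Set Implicit Arguments. Unset Strict Implicit. Unset Printing Implicit Defensive.
Import GRing.Theory.
Local Open Scope ring_scope.

Section Defs.
Variables (K : fieldType) (n m : nat).
(* degrees deg(e_j) of the basis vectors of F *)
Variable degE : 'I_m -> nat.

Definition Spoly := {mpoly K[n]}.
Definition Fmod := {ffun 'I_m -> {mpoly K[n]}}.
(* monomials of F: x^alpha e_j *)
Definition Fmon := ('X_{1..n} * 'I_m)%type.

Definition scaleF (p : {mpoly K[n]}) (v : Fmod) : Fmod := [ffun j => p * v j].
Definition basisF (j : 'I_m) : Fmod := [ffun k => (k == j)%:R].
Definition monF (mu : Fmon) : Fmod := scaleF 'X_[mu.1] (basisF mu.2).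
Definition coefF (v : Fmod) (mu : Fmon) : K := (v mu.2)@_mu.1.
Definition in_suppF (v : Fmod) (mu : Fmon) : bool := coefF v mu != 0.

Definition mondeg (mu : Fmon) : nat := (mdeg mu.1 + degE mu.2)%N.
Definition l_max : nat := (\max_(j < m) degE j)%N.

Definition homogS (d : nat) (p : {mpoly K[n]}) : Prop :=
  forall a, p@_a != 0 -> mdeg a = d.
Definition homogF (d : nat) (v : Fmod) : Prop :=
  forall mu, in_suppF v mu -> mondeg mu = d.
(* degree of a (nonzero homogeneous) element: the degree of its monomials *)
Definition degF (v : Fmod) : nat :=
  (\max_(j < m) \max_(a <- msupp (v j)) (mdeg a + degE j))%N.

Definition in_ideal (I : finType) (G : I -> {mpoly K[n]}) (p : {mpoly K[n]}) : Prop :=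
  exists c : I -> {mpoly K[n]}, p = \sum_i c i * G i.
Definition in_submod (I : finType) (G : I -> Fmod) (v : Fmod) : Prop :=
  exists c : I -> {mpoly K[n]}, v = \sum_i scaleF (c i) (G i).

Definition regular_seq (k : nat) (g : 'I_k -> {mpoly K[n]}) : Prop :=
  (forall (i : 'I_k) (p : {mpoly K[n]}),
     in_ideal (fun i' : {i' : 'I_k | (i' < i)%N} => g (sval i')) (g i * p) ->
     in_ideal (fun i' : {i' : 'I_k | (i' < i)%N} => g (sval i')) p)
  /\ ~ in_ideal g 1.

Definition mulmon (a : 'X_{1..n}) (mu : Fmon) : Fmon := ((a + mu.1)%MM, mu.2).
Definition is_monomial_order (le : rel Fmon) : Prop :=
  [/\ reflexive le, antisymmetric le, transitive le & total le] /\
  (forall a mu nu, le mu nu -> le (mulmon a mu) (mulmon a nu)) /\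
  (forall a mu, le mu (mulmon a mu)).

Definition is_lead (le : rel Fmon) (v : Fmod) (mu : Fmon) : Prop :=
  in_suppF v mu /\ forall nu, in_suppF v nu -> le nu mu.
Definition mdividesF (mu nu : Fmon) : Prop := exists a, nu = mulmon a mu.
Definition in_initial (le : rel Fmon) (M' : Fmod -> Prop) (nu : Fmon) : Prop :=
  exists v mu, [/\ M' v, v != 0, is_lead le v mu & mdividesF mu nu].
Definition NM (le : rel Fmon) (M' : Fmod -> Prop) (v : Fmod) : Prop :=
  forall nu, in_suppF v nu -> ~ in_initial le M' nu.
(* for a monomial submodule: span of the monomials not in it *)
Definition Nmonomial (M' : Fmod -> Prop) (v : Fmod) : Prop :=
  forall nu, in_suppF v nu -> ~ M' (monF nu).

(* cones C(h,u) = h K[u], u a set of variables *)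
Definition cone := (Fmod * {set 'I_n})%type.
Definition in_cone (C : cone) (v : Fmod) : Prop :=
  exists p : {mpoly K[n]},
    (forall a, p@_a != 0 -> forall i, i \notin C.2 -> a i = 0%N)
    /\ v = scaleF p C.1.
Definition cdeg (C : cone) : nat := degF C.1.
Definition cdim (C : cone) : nat := #|C.2|.

Definition cone_decomp (T : Fmod -> Prop) (k : nat) (P : 'I_k -> cone) : Prop :=
  [/\ (forall i, (P i).1 != 0 /\ homogF (degF (P i).1) (P i).1),
      (forall v, T v <-> exists c : 'I_k -> Fmod,
                   (forall i, in_cone (P i) (c i)) /\ v = \sum_i c i) &
      (forall c : 'I_k -> Fmod, (forall i, in_cone (P i) (c i)) ->
                   \sum_i c i = 0 -> forall i, c i = 0)].

Definition cdeg_max (k : nat) (P : 'I_k -> cone) : nat := (\max_i cdeg (P i))%N.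

Definition q_standard (q : nat) (k : nat) (P : 'I_k -> cone) : Prop :=
  (forall i, (0 < cdim (P i))%N -> (q <= cdeg (P i))%N) /\
  (forall i, (0 < cdim (P i))%N -> forall d, (q <= d <= cdeg (P i))%N ->
     exists i', cdeg (P i') = d /\ (cdim (P i) <= cdim (P i'))%N).

Definition q_exact (q : nat) (k : nat) (P : 'I_k -> cone) : Prop :=
  q_standard q P /\
  forall i i', i != i' -> (0 < cdim (P i))%N -> (0 < cdim (P i'))%N ->
    cdeg (P i) != cdeg (P i').

Definition macaulay_b (q : nat) (k : nat) (P : 'I_k -> cone) (j : nat) : nat :=
  maxn q (\max_(i | (j <= cdim (P i))%N) (cdeg (P i)).+1).

Definition genM (r : nat) (g : 'I_(n - r) -> {mpoly K[n]}) (s : nat) (f : 'I_s -> Fmod)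
  (x : ('I_(n - r) * 'I_m) + 'I_s) : Fmod :=
  match x with inl ij => scaleF (g ij.1) (basisF ij.2) | inr t => f t end.
Definition genJF (r : nat) (d : 'I_(n - r) -> nat) (ij : 'I_(n - r) * 'I_m) : Fmod :=
  scaleF ('X_(widen_ord (leq_subr r n) ij.1) ^+ d ij.1) (basisF ij.2).

End Defs.

(* Main.v *)
Require Import Defs.
From HB Require Import structures.
From mathcomp Require Import all_boot all_order all_algebra.
From mathcomp Require Import mpoly zify ring boolp.
Set Implicit Arguments. Unset Strict Implicit. Unset Printing Implicit Defensive.
Import Order.TTheory GRing.Theory Num.Theory.
Local Open Scope ring_scope.

(* A finite family of cones with (degree, dimension) = (a, k) has Hilbert series
   sum X^a / (1 - X)^k; over the common denominator (1 - X)^n it is given by a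
   numerator in Z[X].  Filtering M / (g)F by the f_t, whose successive quotients
   are shifted copies of S / I with I homogeneous, and splitting the complement
   of in(I) into a 0-standard family of cones, one gets a D-standard family B
   such that Q, made D-standard by splitting its cones of degree < D, together
   with B has the same numerator as P, namely the numerator
   sum_j X^(deg e_j) prod_i (1 - X^(d_i)) of F / (g)F and F / JF.
   - Comparing pole orders at 1 degree by degree, a D-standard family cannot have
     a cone of positive dimension beyond the last one of a D-exact family whose
     numerator agrees modulo (1 - X)^n; this bounds the cones of positive
     dimension by b_1.
   - The cones of dimension 0 contribute (1 - X)^n a_0 with a_0 having
     nonnegative coefficients; the degree of the numerator bounds that of a_0. *)

(** * Families of cones *)

(** [Q] and [P] decompose different spaces, and no map between N_M and N_{JF} is used: only degrees
    and dimensions of cones are compared. Hence cones are reduced to pairs of numbers, and [B] need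
    not consist of cones of F; it only has to account for the part of F / (g)F that the f_t remove.
    The comparison needs standardness from one common degree: D >= l provides it for [Q], and D >=
    deg f_t for the layers of [B]. An exact family has at most one cone of positive dimension in
    each degree, so among standard families with the same numerator it is the last to run out of
    such cones. *)

Notation Ym := (1 - 'X : {poly int}).

(* The numerator, over (1 - X)^n, of the Hilbert series of a family of cones
   recorded as pairs (degree, dimension). *)
Definition hnum n (A : seq (nat * nat)) : {poly int} :=
  \sum_(x <- A) 'X^(x.1) * Ym ^+ (n - x.2).

Definition nstandard q (A : seq (nat * nat)) :=
  forall x, x \in A -> (0 < x.2)%N ->
    (q <= x.1)%N /\
    forall e, (q <= e <= x.1)%N -> exists2 k, (x.2 <= k)%N & (e, k) \in A.

Definition dimle n (A : seq (nat * nat)) := forall x, x \in A -> (x.2 <= n)%N.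

(** Cones of dimension 0 contribute multiples of (1 - X)^n, so this congruence sees only the cones
    of positive dimension. *)
Definition congY n (p q : {poly int}) := exists c, p = q + Ym ^+ n * c.

Lemma Ym_neq0 : Ym != 0.
Proof.
by apply/eqP => /(congr1 (fun p : {poly int} => p.[0])); rewrite !hornerE.
Qed.

Lemma hnum_cat n A B : hnum n (A ++ B) = hnum n A + hnum n B.
Proof. by rewrite /hnum big_cat. Qed.

Lemma hnum_perm n A B : perm_eq A B -> hnum n A = hnum n B.
Proof. by move=> AB; apply: perm_big. Qed.

Lemma nstandard_cat q A B :
  nstandard q A -> nstandard q B -> nstandard q (A ++ B).
Proof.
move=> stA stB x; rewrite mem_cat => /orP[xA|xB] x2.
  have [qx h] := stA x xA x2; split=> // e /h [k xk ek]; exists k => //.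
  by rewrite mem_cat ek.
have [qx h] := stB x xB x2; split=> // e /h [k xk ek]; exists k => //.
by rewrite mem_cat ek orbT.
Qed.

Lemma dimle_cat n A B : dimle n A -> dimle n B -> dimle n (A ++ B).
Proof. by move=> dA dB x; rewrite mem_cat => /orP[/dA|/dB]. Qed.

Definition top_dim (A : seq (nat * nat)) := (\max_(x <- A) x.2)%N.

Lemma top_dimP A x : x \in A -> (x.2 <= top_dim A)%N.
Proof. by move=> xA; rewrite /top_dim (big_rem x) //= leq_maxl. Qed.

Lemma top_dim_ex A : (0 < top_dim A)%N -> exists2 x, x \in A & x.2 = top_dim A.
Proof.
rewrite /top_dim; elim: A => [|x A IH]; first by rewrite big_nil.
rewrite big_cons; set t := (\max_(_ <- A) _)%N.
case: (leqP t x.2) => [h _|h].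
  by exists x; rewrite ?mem_head.
move=> t0; have [y yA yt] := IH t0.
by exists y => //; rewrite inE yA orbT.
Qed.

(* The pole order of the Hilbert series at 1 is the largest dimension, because
   the leading coefficients are positive and cannot cancel. *)
Lemma top_dim_cong n A B j : dimle n A ->
  congY n (hnum n A) (hnum n B) -> dimle j B -> dimle j A.
Proof.
move=> dA [c cE] dB; set k := top_dim A.
have [kj|jk] := leqP k j.
  by move=> x /top_dimP; move/leq_trans; apply.
have k0 : (0 < k)%N by apply: leq_ltn_trans jk.
have [x0 x0A x0k] := top_dim_ex k0.
have kn : (k <= n)%N by rewrite /k -x0k dA.
exfalso.
(* Both sides are divisible by (1 - X)^(n - k). Once this is cancelled, the right side still
   vanishes at 1, as dimensions in [B] are at most j < k, while the left side counts the cones of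
   dimension k. *)
have EA : hnum n A = Ym ^+ (n - k) * \sum_(x <- A) 'X^(x.1) * Ym ^+ (k - x.2).
  rewrite mulr_sumr; apply: eq_big_seq => -[a b] xA.
  rewrite mulrCA -exprD; congr (_ * _ ^+ _).
  have := top_dimP xA; rewrite -/k /=; lia.
have EB : hnum n B + Ym ^+ n * c = Ym ^+ (n - k) *
   (Ym * (\sum_(x <- B) 'X^(x.1) * Ym ^+ (k.-1 - x.2) + Ym ^+ k.-1 * c)).
  rewrite [Ym * _]mulrDr mulrDr !mulrA -!exprSr -!exprD; congr (_ + _ ^+ _ * _).
    rewrite mulr_sumr; apply: eq_big_seq => -[a b] xB.
    rewrite mulrCA -exprD; congr (_ * _ ^+ _).
    by have := dB _ xB; move=> /=; lia.
  by lia.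
move: cE; rewrite EA EB => /(mulfI (expf_neq0 _ Ym_neq0)).
move=> /(congr1 (fun p : {poly int} => p.[1])).
rewrite horner_sum [RHS]hornerM hornerD hornerN hornerX hornerC subrr mul0r.
rewrite (big_rem x0) //= x0k -/k subnn expr0 mulr1 hornerXn expr1n => E.
suff: (0 : int) < 0 by rewrite ltxx.
rewrite -[X in _ < X]E; apply: ltr_pwDl => //.
apply: sumr_ge0 => x _; rewrite !hornerE subrr; exact: mulr_ge0 (exprn_ge0 _ _) (exprn_ge0 _ _).
Qed.

Definition split_at q (A : seq (nat * nat)) : seq (nat * nat) :=
  flatten [seq if (x.1 == q) && (0 < x.2)%N
               then (q, 0%N) :: [seq (q.+1, i.+1) | i <- iota 0 x.2]
               else [:: x] | x <- A].

Lemma hnum_split1 n q k : (k <= n)%N ->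
  hnum n ((q, 0%N) :: [seq (q.+1, i.+1) | i <- iota 0 k]) =
  'X^q * Ym ^+ (n - k).
Proof.
elim: k => [|k IH] kn; first by rewrite /hnum big_seq1.
rewrite -[X in iota 0 X]addn1 iotaD map_cat -cat_cons hnum_cat IH ?(ltnW kn) //.
rewrite /hnum big_seq1 /= add0n exprSr -mulrA -mulrDr; congr (_ * _).
have -> : (n - k = (n - k.+1).+1)%N by lia.
by rewrite exprS; ring.
Qed.

Lemma hnum_split n q A : dimle n A -> hnum n (split_at q A) = hnum n A.
Proof.
elim: A => [//|x A IH] dA; rewrite /split_at /= hnum_cat IH; last first.
  by move=> y yA; apply: dA; rewrite inE yA orbT.
rewrite [in RHS]/hnum big_cons -/(hnum n A); congr (_ + _).
case: ifP => [/andP[/eqP <- _]|_]; last by rewrite /hnum big_seq1.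
by rewrite hnum_split1 // dA ?mem_head.
Qed.

Lemma mem_split q A x : x \in A -> (x.1 != q) || (x.2 == 0)%N ->
  x \in split_at q A.
Proof.
move=> xA h; apply/flattenP; exists [:: x]; last by rewrite inE.
by apply/mapP; exists x => //; case: eqP h => //= _ /eqP ->.
Qed.

Lemma splitP q A y : y \in split_at q A ->
  [\/ y \in A /\ ((y.1 != q) || (y.2 == 0)%N), y = (q, 0%N)
   | y.1 = q.+1 /\ exists2 x, x \in A & x.1 = q /\ (0 < y.2 <= x.2)%N].
Proof.
move=> /flattenP [s /mapP [x xA ->]].
case: ifP => [/andP[/eqP xq x0]|h].
  rewrite inE => /orP[/eqP ->|]; first by constructor 2.
  move=> /mapP[i]; rewrite mem_iota => ik -> /=; constructor 3; split=> //.
  by exists x.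
rewrite inE => /eqP ->; constructor 1; split=> //.
by move: h; case: eqP => //= _; case: (x.2).
Qed.

Lemma dimle_split n q A : dimle n A -> dimle n (split_at q A).
Proof.
move=> dA y /splitP [[/dA] // | -> // | [_ [x /dA xn [_ /andP[_ h]]]]].
exact: leq_trans h xn.
Qed.

(** Splitting leaves no cone of positive dimension in degree q, so no witness is required there. The
    weaker hypothesis still holds after a cone of degree q has been removed. *)
Lemma nstandard_split q A : (forall x, x \in A -> (0 < x.2)%N ->
    (q <= x.1)%N /\
    forall e, (q < e <= x.1)%N -> exists2 k, (x.2 <= k)%N & (e, k) \in A) ->
  nstandard q.+1 (split_at q A).
Proof.
move=> stA y yS y0; case: (splitP yS) => [[yA yq]|yE|[y1 _]].
- have [qy h] := stA y yA y0.
  have y1q : y.1 != q by move: yq; rewrite -leqn0 leqNgt y0 orbF.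
  split; first by rewrite ltn_neqAle eq_sym y1q.
  move=> e eq1; have [k yk ekA] := h e eq1; exists k => //.
  by apply: mem_split => //=; case/andP: eq1 => /gtn_eqF ->.
- by rewrite yE in y0.
rewrite y1; split=> // e /anti_leq eE; exists y.2 => //.
by rewrite -eE -y1 -surjective_pairing.
Qed.

(** Splits at q, q + 1, ..., D - 1. The last clause makes it possible to follow an individual cone
    of [Q] into the new family. *)
Lemma raise_standard n q D A : (q <= D)%N -> nstandard q A -> dimle n A ->
  exists A', [/\ nstandard D A', dimle n A', hnum n A' = hnum n A &
    forall x, x \in A -> (x.2 == 0)%N || (D <= x.1)%N -> x \in A'].
Proof.
move=> /subnK <-; elim: (D - q)%N A => [|e IH] A stA dA.
  by exists A; split.
have [A1 [st1 d1 h1 m1]] := IH A stA dA.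
exists (split_at (e + q) A1); split.
- apply: nstandard_split => x xA x0; have [h h'] := st1 x xA x0.
  by split=> // t /andP[/ltnW t1 t2]; apply: h'; rewrite t1.
- exact: dimle_split.
- by rewrite hnum_split.
move=> x xA /orP[x0|x0].
  by apply: mem_split; rewrite ?x0 ?orbT //; apply: m1; rewrite // x0.
by apply: mem_split; [apply: m1 => //; rewrite ltnW ?orbT|rewrite gtn_eqF].
Qed.

(* Both families contain a cone of degree q whose dimension is the common pole
   order; removing it from both sides and splitting the remaining cones of
   degree q of the standard family leads to q+1. *)
Lemma standard_exact_deg n q A P :
  nstandard q A -> nstandard q P -> dimle n A -> dimle n P ->
  uniq (map fst P) -> (forall x, x \in P -> (0 < x.2)%N) ->
  congY n (hnum n A) (hnum n P) ->
  forall x, x \in A -> (0 < x.2)%N -> exists2 y, y \in P & (x.1 <= y.1)%N.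
Proof.
(* Each round removes a cone from [P], whereas splitting may enlarge [A]; hence the induction on
   [size P]. *)
have [N sN] := ubnP (size P); elim: N => // N IH in q A P sN *.
move=> stA stP dA dP uP pP cAP x xA x0.
have cPA : congY n (hnum n P) (hnum n A).
  by case: cAP => c ->; exists (- c); rewrite mulrN addrK.
set k := top_dim A.
have dkA : dimle k A by move=> y; apply: top_dimP.
have dkP : dimle k P by apply: top_dim_cong dP cPA dkA.
have k0 : (0 < k)%N by apply: leq_trans x0 _; apply: dkA.
have tP : top_dim P = k.
  apply/eqP; rewrite eqn_leq; apply/andP; split.
    by apply/bigmax_leqP_seq => y yP _; apply: dkP.
  have dtA : dimle (top_dim P) A.
    by apply: top_dim_cong dA cAP _ => y; apply: top_dimP.
  by apply/bigmax_leqP_seq => y yA _; apply: dtA.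
have qk B : nstandard q B -> top_dim B = k -> (q, k) \in B.
  move=> stB tB; have [|y yB yk] := @top_dim_ex B; first by rewrite tB.
  have [|qy h] := stB y yB; first by rewrite yk tB.
  have [|e ye qe] := h q; first by rewrite leqnn.
  suff -> : k = e by [].
  apply/eqP; rewrite eqn_leq -{1}tB -yk ye -tB.
  exact: (top_dimP qe).
have qkA : (q, k) \in A by apply: qk.
have qkP : (q, k) \in P by apply: qk.
have [xq|xq] := leqP x.1 q; first by exists (q, k).
pose A1 := rem (q, k) A; pose P1 := rem (q, k) P.
have AE : perm_eq A ((q, k) :: A1) by apply: perm_to_rem.
have PE : perm_eq P ((q, k) :: P1) by apply: perm_to_rem.
have subA1 y : y \in A1 -> y \in A by rewrite (perm_mem AE) inE => ->; rewrite orbT.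
have subP1 y : y \in P1 -> y \in P by rewrite (perm_mem PE) inE => ->; rewrite orbT.
have A1m y : y \in A -> y != (q, k) -> y \in A1.
  by rewrite (perm_mem AE) inE => /orP[->|].
have dA1 : dimle n A1 by move=> y /subA1; apply: dA.
have uP' : uniq (map fst ((q, k) :: P1)) by rewrite -(perm_uniq (perm_map _ PE)).
(* Distinct degrees leave nothing else of [P] in degree q, so [P1] starts at q + 1 without being
   split. *)
have P1q y : y \in P1 -> (q < y.1)%N.
  move=> yP1; have [qy _] := stP y (subP1 y yP1) (pP y (subP1 y yP1)).
  rewrite ltn_neqAle qy andbT; apply/eqP => yq.
  by move: uP' => /= /andP[/negP []]; rewrite yq map_f.
suff [y yP1 xy] : exists2 y, y \in P1 & (x.1 <= y.1)%N.
  by exists y => //; apply: subP1.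
apply: (IH q.+1 (split_at q A1) P1) => //.
- by move: sN; rewrite (perm_size PE) /=.
- apply: nstandard_split => y yA1 y0.
  have [qy h] := stA y (subA1 y yA1) y0; split=> // e /andP[qe ey].
  have [|j yj ej] := h e; first by rewrite ltnW.
  by exists j => //; apply: A1m => //; rewrite xpair_eqE gtn_eqF.
- move=> y yP1 y0; have [qy h] := stP y (subP1 y yP1) y0.
  split; first exact: P1q.
  move=> e /andP[qe ey]; have [|j yj ej] := h e; first by rewrite ltnW.
  exists j => //; move: ej; rewrite (perm_mem PE) inE xpair_eqE.
  by rewrite gtn_eqF.
- exact: dimle_split.
- by move=> y /subP1; apply: dP.
- by case/andP: uP'.
- by move=> y /subP1; apply: pP.
- rewrite hnum_split //; case: cAP => c.
  rewrite (hnum_perm _ AE) (hnum_perm _ PE) /hnum !big_cons -addrA.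
  by move=> /addrI ->; exists c.
- apply: mem_split; rewrite ?gtn_eqF //; apply: A1m => //.
  by rewrite [x]surjective_pairing xpair_eqE gtn_eqF.
Qed.

Lemma size_Ym_exp k : size (Ym ^+ k) = k.+1.
Proof.
rewrite -opprB exprNn -signr_odd mulr_sign.
by case: ifP; rewrite ?size_polyN size_exp_XsubC.
Qed.

Lemma deg_dim0 n A b N x :
  (forall y, y \in A -> (0 < y.2)%N -> (y.1 < b)%N) ->
  (size (hnum n A) <= N)%N -> x \in A -> x.2 = 0%N ->
  (x.1 < maxn b (N - n))%N.
Proof.
move=> bA sA xA x0.
pose a0 : {poly int} := \sum_(y <- A | y.2 == 0%N) 'X^(y.1).
pose a1 : {poly int} := \sum_(y <- A | y.2 != 0%N) 'X^(y.1) * Ym ^+ (n - y.2).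
have EA : hnum n A = a0 * Ym ^+ n + a1.
  rewrite /hnum (bigID (fun y : nat * nat => y.2 == 0%N)) /= mulr_suml.
  by congr (_ + _); apply: eq_bigr => y /eqP ->; rewrite subn0.
have c0 : a0`_(x.1) != 0.
  rewrite coef_sum (big_rem x) //= x0 /= coefXn eqxx lt0r_neq0 //.
  apply: ltr_pwDl => //; apply: sumr_ge0 => y _; rewrite coefXn.
  by case: eqP.
have xs : (x.1 < size a0)%N by rewrite ltnNge; apply: contra c0 => /leq_sizeP ->.
apply: leq_trans xs _.
have a00 : a0 != 0 by apply: contraNneq c0 => ->; rewrite coef0.
have s0 : size (a0 * Ym ^+ n) = (size a0 + n)%N.
  by rewrite size_mul ?expf_neq0 ?Ym_neq0 // size_Ym_exp addnS.
(* A term of [a1] has its generator in degree below b and at most n - 1 factors 1 - X. *)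
have s1 : (size a1 <= b + n)%N.
  apply: (leq_trans (size_sum _ _ _)).
  apply/bigmax_leqP_seq => y yA y0; rewrite -lt0n in y0.
  apply: (leq_trans (size_polyMleq _ _)); rewrite size_polyXn size_Ym_exp /=.
  by have := bA y yA y0; lia.
have : (size (a0 * Ym ^+ n)%R <= maxn N (b + n))%N.
  have -> : a0 * Ym ^+ n = hnum n A - a1 by rewrite EA addrK.
  apply: (leq_trans (size_polyD _ _)); rewrite size_polyN.
  by rewrite geq_max !leq_max sA s1 orbT.
by rewrite s0; lia.
Qed.

(** * Hilbert functions of families of monomials *)

(** Multiplication of a generating function by X^d; the test guards against truncated subtraction.
    The codomain is generic because counts live in nat and their differences in int. *)
Definition delay (V : nmodType) d (f : nat -> V) z : V :=
  if (d <= z)%N then f (z - d)%N else 0.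

Definition nabla (f : nat -> int) z : int := f z - delay 1 f z.

(* The generating function of f is p / (1 - X)^n. *)
Definition hasnum n (f : nat -> nat) (p : {poly int}) :=
  forall z, iter n nabla (fun z => (f z)%:Z) z = p`_z.

Lemma delay_ext (V : nmodType) d (f g : nat -> V) : f =1 g -> delay d f =1 delay d g.
Proof. by move=> fg z; rewrite /delay fg. Qed.

Lemma delay_delay (V : nmodType) d e (f : nat -> V) z :
  delay d (delay e f) z = delay (d + e) f z.
Proof.
rewrite /delay; case: (leqP d z) => h; last by rewrite leqNgt ltn_addr.
by rewrite leq_subRL // subnDA.
Qed.

Lemma delayD (V : nmodType) d (f g : nat -> V) z :
  delay d (fun z => f z + g z) z = delay d f z + delay d g z.
Proof. by rewrite /delay; case: ifP => //; rewrite addr0. Qed.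

Lemma delayN (V : zmodType) d (f : nat -> V) z :
  delay d (fun z => - f z) z = - delay d f z.
Proof. by rewrite /delay; case: ifP => //; rewrite oppr0. Qed.

Lemma delayZ d f z : (delay d f z)%:Z = delay d (fun z => (f z)%:Z) z.
Proof. by rewrite /delay; case: ifP. Qed.

Lemma iter_nabla_ext k f g : f =1 g -> iter k nabla f =1 iter k nabla g.
Proof.
move=> fg; elim: k => [//|k IH] z.
by rewrite !iterS /nabla IH (delay_ext _ IH).
Qed.

Lemma iter_nablaD k f g z :
  iter k nabla (fun z => f z + g z) z = iter k nabla f z + iter k nabla g z.
Proof.
elim: k z => [//|k IH] z.
rewrite !iterS /nabla IH (delay_ext _ IH) delayD; ring.
Qed.

Lemma iter_nabla_delay k d f z :
  iter k nabla (delay d f) z = delay d (iter k nabla f) z.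
Proof.
elim: k z => [//|k IH] z.
rewrite !iterS /nabla IH (delay_ext _ IH) delayD delayN !delay_delay.
by rewrite [(1 + d)%N]addnC.
Qed.

Lemma delay_coef d (p : {poly int}) z :
  delay d (fun z => p`_z) z = ('X^d * p)`_z.
Proof. by rewrite /delay coefXnM; case: leqP. Qed.

Lemma nabla_coef k (p : {poly int}) z :
  iter k nabla (fun z => p`_z) z = (Ym ^+ k * p)`_z.
Proof.
elim: k z => [|k IH] z; first by rewrite mul1r.
rewrite iterS /nabla IH.
rewrite (@delay_ext int _ _ (fun z => (Ym ^+ k * p)`_z) IH) delay_coef -coefB.
by congr (_`_z); rewrite expr1 exprS -mulrA mulrBl mul1r.
Qed.

Lemma hasnum_ext n f g p : f =1 g -> hasnum n f p -> hasnum n g p.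
Proof.
by move=> fg fp z; rewrite -fp; apply: iter_nabla_ext => y; rewrite fg.
Qed.

Lemma hasnum_inj n f p q : hasnum n f p -> hasnum n f q -> p = q.
Proof. by move=> fp fq; apply/polyP => z; rewrite -fp fq. Qed.

Lemma hasnum0 n : hasnum n (fun=> 0%N) 0.
Proof.
move=> z; rewrite -[RHS](congr1 (fun p : {poly int} => p`_z) (mulr0 (Ym ^+ n))).
by rewrite -nabla_coef; apply: iter_nabla_ext => y; rewrite coef0.
Qed.

Lemma hasnumD n f g p q :
  hasnum n f p -> hasnum n g q -> hasnum n (fun z => f z + g z)%N (p + q).
Proof.
move=> fp gq z; rewrite coefD -fp -gq -iter_nablaD.
by apply: iter_nabla_ext => y; rewrite PoszD.
Qed.

Lemma hasnum_addr n f g h p q : (forall z, h z = f z + g z)%N ->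
  hasnum n h p -> hasnum n f q -> hasnum n g (p - q).
Proof.
move=> hE hp fq z; rewrite coefB -hp -fq.
apply/eqP; rewrite eq_sym subr_eq addrC -iter_nablaD; apply/eqP.
by apply: iter_nabla_ext => y; rewrite hE PoszD.
Qed.

Lemma hasnum_delay n d f p :
  hasnum n f p -> hasnum n (delay d f) ('X^d * p).
Proof.
move=> fp z; rewrite (iter_nabla_ext _ (fun y => delayZ d f y)) iter_nabla_delay.
by rewrite (@delay_ext int _ _ (fun z => p`_z) fp) delay_coef.
Qed.

Lemma hasnum_sum (I : Type) (r : seq I) n (f : I -> nat -> nat) p :
  (forall i, hasnum n (f i) (p i)) ->
  hasnum n (fun z => \sum_(i <- r) f i z)%N (\sum_(i <- r) p i).
Proof.
move=> fp; elim: r => [|i r IH].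
  by rewrite big_nil; apply: hasnum_ext (hasnum0 n) => z; rewrite big_nil.
rewrite big_cons; apply: hasnum_ext (hasnumD (fp i) IH) => z.
by rewrite big_cons.
Qed.

(** The hypothesis says that (1 - X) times the series of f is the series of g. *)
Lemma hasnumS k f g p : (forall z, f z = g z + delay 1 f z)%N ->
  hasnum k g p -> hasnum k.+1 f p.
Proof.
move=> fE gp z; rewrite iterSr -gp; apply: iter_nabla_ext => y.
by rewrite /nabla {1}fE PoszD delayZ addrK.
Qed.

Lemma hasnum_raise n k f p : (k <= n)%N ->
  hasnum k f p -> hasnum n f (Ym ^+ (n - k) * p).
Proof.
move=> kn fp z; rewrite -{1}(subnK kn) iterD (iter_nabla_ext _ fp).
exact: nabla_coef.
Qed.

Lemma card_bij (T T' : finType) (A : pred T) (B : pred T') (f : T -> T') g :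
  (forall x, A x -> B (f x) /\ g (f x) = x) ->
  (forall y, B y -> A (g y) /\ f (g y) = y) -> #|A| = #|B|.
Proof.
move=> Af Bg; rewrite -(card_in_image (f := f) (A := A)); last first.
  by move=> x y /Af[_ {2}<-] /Af[_ {2}<-] ->.
apply: eq_card => y; apply/imageP/idP => [[x xA ->]|yB].
  by have [] := Af x xA.
by have [gA gy] := Bg y yB; exists (g y).
Qed.

Section Count.
Variable n : nat.
Implicit Types U : 'X_{1..n} -> bool.

Definition cnt U z :=
  #|[pred a : 'X_{1..n < z.+1} | (mdeg a == z) && U (bmnm a)]|.

Definition bmon b (a : 'X_{1..n}) : 'X_{1..n < b.+1} := insubd bm0 a.

Lemma bmonK b a : (mdeg a <= b)%N -> bmnm (bmon b a) = a.
Proof. by move=> h; apply: insubdK. Qed.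

Lemma bmonE b c (a : 'X_{1..n < c}) : (mdeg a <= b)%N -> bmnm (bmon b a) = a.
Proof. by move=> h; apply: insubdK. Qed.

Lemma cnt_ext U U' z : (forall a, mdeg a = z -> U a = U' a) -> cnt U z = cnt U' z.
Proof.
by move=> UU; apply: eq_card => a; rewrite !inE; case: eqP => //= /UU.
Qed.

Lemma cnt_bound U z b : (z <= b)%N ->
  #|[pred a : 'X_{1..n < b.+1} | (mdeg a == z) && U (bmnm a)]| = cnt U z.
Proof.
move=> zb.
apply: (@card_bij _ _ _ _ (fun a : 'X_{1..n < b.+1} => bmon z a)
                          (fun a : 'X_{1..n < z.+1} => bmon b a)).
  move=> a /andP[/eqP da Ua]; have e : bmnm (bmon z a) = a by rewrite bmonE ?da.
  by split; [rewrite /= e da eqxx|apply: val_inj; rewrite /= e bmonK ?da].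
move=> a /andP[/eqP da Ua]; have e : bmnm (bmon b a) = a by rewrite bmonE ?da.
by split; [rewrite /= e da eqxx|apply: val_inj; rewrite /= e bmonK ?da].
Qed.

(** Monomials with exponent at least d at i are the multiples of x_i^d, and dividing by it gives the
    delayed term. With d = 1 this splits along a variable, with d = d_i it cuts out the box of a
    monomial complete intersection. *)
Lemma cnt_split U (i : 'I_n) d z :
  cnt U z = (cnt (fun a => U a && (a i < d)) z +
             delay d (cnt (fun a => U (a + U_(i) *+ d)%MM)) z)%N.
Proof.
pose A := [pred a : 'X_{1..n < z.+1} | (mdeg a == z) && U (bmnm a)].
pose B := [pred a : 'X_{1..n < z.+1} | bmnm a i < d]%N.
rewrite [LHS](_ : _ = #|[predI A & B]| + #|[predD A & B]|)%N; last by rewrite cardID.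
congr (_ + _)%N.
  by apply: eq_card => a; rewrite !inE /= andbA.
have di a : (U_(i) *+ d <= a)%MM = (d <= a i)%N.
  apply/mnm_lepP/idP => [/(_ i)|h j].
    by rewrite mulmnE mnm1E eqxx mul1n.
  by rewrite mulmnE mnm1E; case: eqP => [<-|]; rewrite ?mul1n.
rewrite /delay; case: leqP => dz; last first.
  apply: eq_card0 => a; rewrite !inE /= -leqNgt.
  apply/negP => /andP[h /andP[/eqP az _]].
  have : (a i <= mdeg a)%N.
    by rewrite mdegE (bigD1 i) //= leq_addr.
  by move: h dz; rewrite az; lia.
apply: (@card_bij _ _ _ _
  (fun a : 'X_{1..n < z.+1} => bmon (z - d) (a - U_(i) *+ d)%MM)
  (fun a : 'X_{1..n < (z - d).+1} => bmon z (a + U_(i) *+ d)%MM)).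
  move=> a; rewrite /= !inE -leqNgt => /andP[h /andP[/eqP az Ua]].
  have e : ((a - U_(i) *+ d) + U_(i) *+ d = a)%MM by rewrite submK // di.
  have da : mdeg (a - U_(i) *+ d)%MM = (z - d)%N.
    have := congr1 mdeg e; rewrite mdegD mdegMn mdeg1 mul1n az => h'.
    by apply/eqP; rewrite -(eqn_add2r d) h' subnK.
  have e' : bmnm (bmon (z - d) (a - U_(i) *+ d)%MM) = (a - U_(i) *+ d)%MM.
    by rewrite bmonK ?da.
  split; first by rewrite e' da eqxx e.
  by apply: val_inj; rewrite /= e' e bmonK // az.
move=> a /= /andP[/eqP az Ua].
have da : mdeg (a + U_(i) *+ d)%MM = z.
  by rewrite mdegD mdegMn mdeg1 mul1n az subnK.
have e' : bmnm (bmon z (a + U_(i) *+ d)%MM) = (a + U_(i) *+ d)%MM.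
  by rewrite bmonK ?da.
split; first by rewrite !inE e' da eqxx Ua andbT -leqNgt -di lem_addl.
by apply: val_inj; rewrite /= e' addmK bmonK // az.
Qed.

Definition supp_in (u : {set 'I_n}) (a : 'X_{1..n}) :=
  [forall i, (i \notin u) ==> (a i == 0%N)].

Lemma cnt_supp_in (u : {set 'I_n}) : hasnum #|u| (cnt (supp_in u)) 1.
Proof.
move: {2}#|u| (erefl #|u|) => k; elim: k u => [|k IH] u uk.
  rewrite uk => z; rewrite coef1 /=.
  suff -> : cnt (supp_in u) z = (z == 0%N) by case: eqP.
  rewrite /cnt (eq_card (B := [pred a : 'X_{1..n < z.+1} | (z == 0%N) && (a == bm0)])).
    by case: (z =P 0%N) => [->|_]; [rewrite card1 | rewrite card0].
  move=> a; rewrite !inE; apply/andP/andP => -[].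
    move=> /eqP az /forallP sa; suff a0 : bmnm a = 0%MM.
      split; first by apply/eqP; move: az; rewrite a0 mdeg0 => ->.
      by apply/eqP; apply: val_inj; rewrite /= a0.
    apply/mnmP => i; rewrite mnm0E; apply/eqP.
    by have := sa i; rewrite (cards0_eq uk) inE.
  move=> /eqP z0 /eqP -> /=; rewrite mdeg0 z0; split=> //.
  by apply/forallP => i; rewrite mnm0E eqxx implybT.
have /card_gt0P [i iu] : (0 < #|u|)%N by rewrite uk.
have uk' : #|u :\ i| = k by have := cardsD1 i u; rewrite iu uk add1n => -[].
rewrite uk; rewrite -uk'; apply: hasnumS (IH _ uk') => z.
rewrite (cnt_split _ i 1) /delay; congr (_ + _)%N.
  apply: cnt_ext => a _; apply/andP/forallP => [[/forallP sa ai] j|sa].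
    rewrite !inE negb_and negbK; apply/implyP => /orP[/eqP ->|ju].
      by rewrite -leqn0 -ltnS.
    exact: (implyP (sa j)).
  split; last by have := sa i; rewrite !inE eqxx /= => /eqP ->.
  apply/forallP => j; apply/implyP => ju; apply: (implyP (sa j)).
  by rewrite !inE (negbTE ju) andbF.
case: ifP => // _; apply: cnt_ext => a _; apply: eq_forallb => j.
rewrite mnmDE mulmnE muln1 mnm1E; case: (i =P j) => [<-|_]; rewrite ?addn0 //.
by rewrite iu.
Qed.

End Count.

(** * Complements of monomial ideals *)

(** On every tail choose an index where u is minimal, then continue with the tail strictly after
    it. *)
Lemma nat_subseq_monotone (u : nat -> nat) : exists2 phi : nat -> nat,
  {homo phi : a b / (a < b)%N} & {homo u \o phi : a b / (a <= b)%N}.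
Proof.
have ex N : exists k, (N <= k)%N /\ forall j, (N <= j)%N -> (u k <= u j)%N.
  have exv : exists v, `[< exists2 k, (N <= k)%N & u k = v >].
    by exists (u N); apply/asboolP; exists N.
  case: (ex_minnP exv) => v /asboolP[k Nk <-] vmin.
  by exists k; split=> // j Nj; apply: vmin; apply/asboolP; exists j.
have [g gP] := choice ex.
pose phi k := iter k (fun a => g a.+1) (g 0).
have lt a : (phi a < phi a.+1)%N by case: (gP (phi a).+1).
have phi_lt : {homo phi : a b / (a < b)%N} by apply: homo_ltn => //; apply: ltn_trans.
exists phi => //; apply: homo_leq => [//|b a c|a]; first exact: leq_trans.
have [N E] : exists N, phi a = g N by case: a => [|a]; [exists 0|exists (phi a).+1].
have [Ng h] := gP N; rewrite /= E; apply: h.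
by apply: leq_trans Ng _; rewrite -E ltnW.
Qed.

Lemma dickson n (f : nat -> 'X_{1..n}) : exists i j, (i < j)%N /\ (f i <= f j)%MM.
Proof.
suff H (s : seq 'I_n) : exists2 phi : nat -> nat, {homo phi : a b / (a < b)%N} &
    forall i, i \in s -> {homo (fun k => f (phi k) i) : a b / (a <= b)%N}.
  have [phi lt le] := H (enum 'I_n).
  exists (phi 0), (phi 1); split; first exact: lt.
  by apply/mnm_lepP => i; apply: (le i) => //; rewrite mem_enum.
elim: s => [|i s [phi lt le]]; first by exists id.
have [psi lt' le'] := nat_subseq_monotone (fun k => f (phi k) i).
exists (phi \o psi) => [a b /lt' /lt //|j].
rewrite inE => /orP[/eqP ->|js] a b ab; first exact: le'.
apply: (le j js); move: ab; rewrite leq_eqVlt => /orP[/eqP -> //|/lt' /ltnW //].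
Qed.

Section Staircase.
Variable n : nat.
Implicit Types U : 'X_{1..n} -> bool.

Definition upset U := forall a b : 'X_{1..n}, U a -> U (b + a)%MM.

(** Noetherian induction on monomial ideals. A strictly ascending chain yields monomials a_k in
    U_(k+1) but not in U_k; Dickson's lemma finds i < j with a_i dividing a_j, so a_j lies in U_j, a
    contradiction. *)
Lemma upset_ind (Pr : ('X_{1..n} -> bool) -> Prop) :
  (forall U, upset U ->
     (forall U', upset U' -> (forall a, U a -> U' a) ->
        (exists a, U' a && ~~ U a) -> Pr U') -> Pr U) ->
  forall U, upset U -> Pr U.
Proof.
move=> step U0 up0; apply: contrapT => nP0.
pose T := {U | upset U /\ ~ Pr U}.
have next (x : T) : exists y : T, (forall a, sval x a -> sval y a) /\
    exists a, sval y a && ~~ sval x a.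
  case: x => U [upU nP] /=; apply: contrapT => h; apply: nP; apply: step => //.
  move=> U' up' sub ex; apply: contrapT => nP'; apply: h.
  by exists (exist _ U' (conj up' nP')).
have [g gP] := choice next.
pose x k := iter k g (exist _ U0 (conj up0 nP0) : T).
have sub a : {homo (fun k => sval (x k) a) : j k / (j <= k)%N >-> j ==> k}.
  apply: homo_leq => [b|b c d|k]; first exact: implybb.
    by case: b; case: c; case: d.
  by apply/implyP; case: (gP (x k)) => + _; apply.
have [f fP] := choice (fun k => (gP (x k)).2).
have [i [j [ij le]]] := dickson f.
have /andP[fi _] := fP i; have /andP[_ /negP []] := fP j.
rewrite -(submK le); apply: (svalP (x j)).1.
exact: implyP (sub _ _ _ ij) fi.
Qed.

(** u is an independent set of variables modulo the monomial ideal U; for proper U the largest such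
    size is the dimension of the quotient. *)
Definition free_of U (u : {set 'I_n}) := forall a, supp_in u a -> ~~ U a.

Definition shift d (A : seq (nat * nat)) := [seq ((d + x.1)%N, x.2) | x <- A].

Lemma hnum_shift d A : hnum n (shift d A) = 'X^d * hnum n A.
Proof.
rewrite /hnum big_map mulr_sumr; apply: eq_bigr => x _ /=.
by rewrite exprD mulrA.
Qed.

Lemma dimle_shift k d A : dimle k A -> dimle k (shift d A).
Proof. by move=> dA x /mapP[y /dA yk ->]. Qed.

Lemma nstandard_shift q d A : nstandard q A -> nstandard (d + q) (shift d A).
Proof.
move=> stA x /mapP[[a b] yA ->] /= y0; have /= [qy h] := stA _ yA y0.
split; first by rewrite leq_add2l.
move=> e he; have [|k yk ek] := h (e - d)%N; first by lia.
exists k => //; apply/mapP; exists ((e - d)%N, k) => //=; congr (_, _); lia.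
Qed.

Lemma supp_in0 (u : {set 'I_n}) : supp_in u 0%MM.
Proof. by apply/forallP => i; rewrite mnm0E eqxx implybT. Qed.

Lemma upset_sub U (a b : 'X_{1..n}) : upset U -> (a <= b)%MM -> U a -> U b.
Proof. by move=> up ab Ua; rewrite -(submK ab); apply: up. Qed.

(* Dube's splitting: for a maximal free set u and a variable x_i outside u
   which is not in U, the complement of U is the disjoint union of the
   complement of U + (x_i) and of x_i times the complement of (U : x_i). *)
Lemma staircase_strong U : upset U -> exists A,
  [/\ hasnum n (cnt (fun a => ~~ U a)) (hnum n A), nstandard 0 A,
      forall x, x \in A -> exists2 u, free_of U u & #|u| = x.2 &
      forall u, free_of U u -> exists2 k, (#|u| <= k)%N & (0%N, k) \in A].
Proof.
move: U; apply: upset_ind => U up IH.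
have [U0|U0] := boolP (U 0%MM).
  exists [::]; split=> //.
    rewrite /hnum big_nil; apply: hasnum_ext (hasnum0 n) => z.
    apply/esym/eq_card0 => a; rewrite !inE.
    by have := up 0%MM a U0; rewrite addm0 => ->; rewrite andbF.
  by move=> u /(_ 0%MM (supp_in0 u)); rewrite U0.
have free0 : `[<free_of U set0>].
  apply/asboolP => a /forallP h; suff -> : a = 0%MM by [].
  apply/mnmP => i; rewrite mnm0E; apply/eqP; by have := h i; rewrite in_set0.
case: (@arg_maxnP _ set0 (fun u => `[<free_of U u>])
  (fun u : {set 'I_n} => #|u|) free0) => u /asboolP fu umax.
have {umax} umax v : free_of U v -> (#|v| <= #|u|)%N by move=> /asboolP; apply: umax.
have [/existsP[i /andP[iu iU]]|nex] := boolP [exists i, (i \notin u) && ~~ U U_(i)%MM]; last first.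
  (* All variables outside [u] lie in [U], so the monomials outside [U] are exactly those of K[u]:
     one cone. *)
  exists [:: (0%N, #|u|)]; split.
  - rewrite /hnum big_seq1 expr0 mul1r -[_ ^+ _]mulr1.
    apply: hasnum_ext (hasnum_raise _ (cnt_supp_in u)); last first.
      by rewrite -[X in (_ <= X)%N]card_ord max_card.
    move=> z; apply: cnt_ext => a _; apply/idP/idP => [/fu //|nU].
    apply/forallP => i; apply/implyP => iu; apply: contraR nU => ai.
    have : U U_(i)%MM.
      by apply: contraR nex => iU; apply/existsP; exists i; rewrite iu.
    apply: upset_sub => //; apply/mnm_lepP => j; rewrite mnm1E.
    by case: (i =P j) => // <-; rewrite lt0n.
  - move=> x; rewrite inE => /eqP -> _; split=> // e; rewrite leqn0 => /eqP ->.
    by exists #|u|; rewrite ?mem_head.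
  - by move=> x; rewrite inE => /eqP ->; exists u.
  by move=> v /umax vu; exists #|u|; rewrite ?mem_head.
pose U1 a := U a || (0 < a i)%N; pose U2 a := U (a + U_(i))%MM.
have up1 : upset U1.
  move=> a b; rewrite /U1 mnmDE addn_gt0 => /orP[/(up _ b) ->|->] //.
  by rewrite !orbT.
have up2 : upset U2 by move=> a b; rewrite /U2 -addmA; apply: up.
have [|||A1 [n1 st1 f1 e1]] := IH U1 => //.
- by move=> a; rewrite /U1 => ->.
- by exists U_(i)%MM; rewrite /U1 (negbTE iU) mnm1E eqxx.
have [|||A2 [n2 st2 f2 e2]] := IH U2 => //.
- by move=> a; rewrite /U2 addmC; apply: up.
(* Why (U : x_i) is strictly larger than U: by maximality of u some w x_i^k with w in K[u] lies in
   U. As w does not, the least such k is positive, and w x_i^(k-1) is the new element. *)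
- have [a sa Ua] : exists2 a, supp_in (i |: u) a & U a.
    apply: contrapT => h.
    suff /umax : free_of U (i |: u) by rewrite cardsU1 iu add1n ltnn.
    by move=> a sa; apply/negP => Ua; apply: h; exists a.
  pose w := [multinom if j == i then 0%N else a j | j < n].
  have aw : a = (w + U_(i) *+ (a i))%MM.
    apply/mnmP => j; rewrite mnmDE mulmnE mnm1E mnmE [j == i]eq_sym.
    by case: (i =P j) => [<-|_]; rewrite ?mul1n ?addn0.
  have nw : ~~ U w.
    apply: fu; apply/forallP => j; rewrite mnmE; apply/implyP => ju.
    case: (j =P i) => // /eqP ji; apply: (implyP (forallP sa j)).
    by rewrite !inE negb_or ji.
  have exk : exists k, U (w + U_(i) *+ k)%MM by exists (a i); rewrite -aw.
  case: (ex_minnP exk) => -[|k] Uk kmin; first by rewrite mulm0n addm0 (negbTE nw) in Uk.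
  exists (w + U_(i) *+ k)%MM; rewrite /U2 -addmA -[(_ + U_(i))%MM]addmC -mulmS Uk.
  by apply/negP => /kmin; rewrite ltnn.
exists (A1 ++ shift 1 A2); split.
- rewrite hnum_cat hnum_shift.
  apply: hasnum_ext (hasnumD n1 (hasnum_delay 1 n2)) => z.
  rewrite [RHS](cnt_split _ i 1) /delay; congr (_ + _)%N.
    by apply: cnt_ext => a _; rewrite negb_or lt0n negbK ltnS leqn0.
- move=> x; rewrite mem_cat => /orP[xA1|/mapP[y yA2 ->]] x0.
    have [_ h] := st1 x xA1 x0; split=> // e /h [k xk ek].
    by exists k => //; rewrite mem_cat ek.
  (* The shifted cones start in degree 1, so their witness in degree 0 must come from [A1]. It has a
     cone of dimension at least #|u| there, and no dimension in [A2] exceeds #|u|; this is what the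
     last two clauses of the statement are for. *)
  split=> // -[_|e /= ey].
    have [v fv vy] := f2 y yA2.
    have [|k uk ek] := e1 u.
      move=> a sa; rewrite negb_or fu // -eqn0Ngt.
      exact: (implyP (forallP sa i)).
    exists k; last by rewrite mem_cat ek.
    rewrite /= -vy; apply: leq_trans uk; apply: umax => a /fv.
    by apply: contra => /(up a U_(i)%MM); rewrite addmC.
  have [_ h] := st2 y yA2 x0; have [|k yk ek] := h e; first by rewrite -ltnS -add1n.
  by exists k => //; rewrite mem_cat; apply/orP; right; apply/mapP; exists (e, k).
- move=> x; rewrite mem_cat => /orP[/f1[v fv <-]|/mapP[y /f2[v fv vy] ->]].
    by exists v => // a /fv; apply: contra; rewrite /U1 => ->.
  exists v => // a /fv; apply: contra => /(up a U_(i)%MM).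
  by rewrite addmC.
move=> v /umax vu; have [|k uk ek] := e1 u.
  move=> a sa; rewrite negb_or fu // -eqn0Ngt.
  exact: (implyP (forallP sa i)).
by exists k; rewrite ?mem_cat ?ek // (leq_trans vu).
Qed.

Lemma staircase U : upset U -> exists A,
  [/\ hasnum n (cnt (fun a => ~~ U a)) (hnum n A), nstandard 0 A & dimle n A].
Proof.
move=> /staircase_strong [A [nA stA fA _]]; exists A; split=> // x /fA[u _ <-].
by rewrite -[X in (_ <= X)%N]card_ord max_card.
Qed.

End Staircase.

(** * Bases of quotients of graded modules *)

Section QuotientBasis.
Variables (K : fieldType) (V : lmodType K).
Implicit Types W : V -> Prop.

Definition subsp W := W 0 /\ forall (c : K) u v, W u -> W v -> W (c *: u + v).

(* b is a basis of W / W'. *)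
Definition qbasis (I : finType) (b : I -> V) W W' :=
  [/\ forall i, W (b i),
      forall w, W w -> exists c : I -> K, W' (w - \sum_i c i *: b i) &
      forall c : I -> K, W' (\sum_i c i *: b i) -> forall i, c i = 0].

Lemma subspD W u v : subsp W -> W u -> W v -> W (u + v).
Proof. by case=> _ h Wu Wv; rewrite -[u]scale1r; apply: h. Qed.

Lemma subspZ W c u : subsp W -> W u -> W (c *: u).
Proof. by case=> W0 h Wu; rewrite -[_ *: _]addr0; apply: h. Qed.

Lemma subspN W u : subsp W -> W u -> W (- u).
Proof. by move=> sW Wu; rewrite -scaleN1r; apply: subspZ. Qed.

Lemma subspB W u v : subsp W -> W u -> W v -> W (u - v).
Proof. by move=> sW Wu Wv; apply: subspD => //; apply: subspN. Qed.

Lemma subsp_sum W (I : Type) (r : seq I) (P : pred I) (F : I -> V) : subsp W ->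
  (forall i, P i -> W (F i)) -> W (\sum_(i <- r | P i) F i).
Proof.
by move=> sW h; elim/big_rec: _ => [|i x Pi Wx]; [case: sW|apply: subspD; auto].
Qed.

(** If I were larger than J, the matrix expressing b through b' would have a nonzero left kernel,
    and each kernel row is a relation among the b i modulo W'. *)
Lemma qbasis_card_le (I J : finType) (b : I -> V) (b' : J -> V) W W' :
  subsp W' -> qbasis b W W' -> qbasis b' W W' -> (#|I| <= #|J|)%N.
Proof.
move=> sW' [bW _ bfree] [_ bspan _].
have [A AP] := choice (fun i => bspan (b i) (bW i)).
pose B : 'M[K]_(#|I|, #|J|) := \matrix_(i, j) A (enum_val i) (enum_val j).
rewrite leqNgt; apply/negP => JI.
have /negP[] : ~~ row_free B.
  by rewrite -row_leq_rank -ltnNge (leq_ltn_trans (rank_leq_col B)).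
rewrite -kermx_eq0; apply/eqP/row_matrixP => i0; rewrite row0.
have /sub_kermxP rB : (row i0 (kermx B) <= kermx B)%MS by apply: row_sub.
set x := row i0 _ in rB *.
pose c i := x 0 (enum_rank i).
suff cz i : c i = 0.
  by apply/rowP => k; rewrite [RHS]mxE; have := cz (enum_val k); rewrite /c enum_valK.
apply: bfree.
have -> : \sum_i c i *: b i = \sum_i c i *: (b i - \sum_j A i j *: b' j).
  under [RHS]eq_bigr do rewrite scalerBr scaler_sumr.
  rewrite sumrB exchange_big /= [X in _ - X]big1 ?subr0 // => j _.
  under eq_bigr do rewrite scalerA.
  rewrite -scaler_suml; set t := (X in X *: _); suff -> : t = 0 by rewrite scale0r.
  have := congr1 (fun y : 'rV_ _ => y 0 (enum_rank j)) rB; rewrite mxE [RHS]mxE => <-.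
  rewrite /t (reindex (@enum_val I predT)) /=; last first.
    by apply: onW_bij; apply: enum_val_bij.
  by apply: eq_bigr => k _; rewrite /c enum_valK [B _ _]mxE enum_rankK.
by apply: subsp_sum => // k _; apply: subspZ.
Qed.

Lemma qbasis_card (I J : finType) (b : I -> V) (b' : J -> V) W W' :
  subsp W' -> qbasis b W W' -> qbasis b' W W' -> #|I| = #|J|.
Proof.
move=> sW' h h'; apply/eqP; rewrite eqn_leq.
by rewrite (qbasis_card_le sW' h h') (qbasis_card_le sW' h' h).
Qed.

Lemma qbasis_trans (I J : finType) (b : I -> V) (b' : J -> V) W1 W2 W3 :
  subsp W2 -> (forall v, W2 v -> W1 v) -> (forall v, W3 v -> W2 v) ->
  qbasis b W1 W2 -> qbasis b' W2 W3 ->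
  qbasis (fun x : I + J => match x with inl i => b i | inr j => b' j end) W1 W3.
Proof.
move=> s2 h12 h23 [bW bs bf] [bW' bs' bf']; split.
- by case=> [i|j] //; apply: h12.
- move=> w /bs [c /bs' [c' h]].
  exists (fun x => match x with inl i => c i | inr j => c' j end).
  by rewrite big_sumType /= opprD addrA.
move=> c; rewrite big_sumType /= => h.
have cl i : c (inl i) = 0.
  apply: (bf (fun i => c (inl i))); rewrite -[X in W2 X](addrK (\sum_j c (inr j) *: b' j)).
  apply: subspB => //; first exact: h23.
  by apply: subsp_sum => // j _; apply: subspZ.
case=> [//|j]; apply: (bf' (fun j => c (inr j))).
by move: h; rewrite big1 ?add0r // => i _; rewrite cl scale0r.
Qed.

End QuotientBasis.

(** * Homogeneous components and graded submodules of F *)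

Section Graded.
Variables (K : fieldType) (n m : nat) (degE : 'I_m -> nat).
Notation F := (Fmod K n m).
Implicit Types (u v w : F) (mu nu : Fmon n m) (W : F -> Prop).

Lemma coefFD u v mu : coefF (u + v) mu = coefF u mu + coefF v mu.
Proof. by rewrite /coefF ffunE mcoeffD. Qed.

Lemma coefFZ (c : K) v mu : coefF (c *: v) mu = c * coefF v mu.
Proof. by rewrite /coefF ffunE mcoeffZ. Qed.

Lemma coefFN v mu : coefF (- v) mu = - coefF v mu.
Proof. by rewrite /coefF ffunE mcoeffN. Qed.

Lemma coefF0 mu : coefF (0 : F) mu = 0.
Proof. by rewrite /coefF ffunE mcoeff0. Qed.

Lemma coefF_sum (I : Type) (r : seq I) (P : pred I) (G : I -> F) mu :
  coefF (\sum_(i <- r | P i) G i) mu = \sum_(i <- r | P i) coefF (G i) mu.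
Proof.
by elim/big_rec2: _ => [|i x y _ <-]; rewrite ?coefF0 // coefFD.
Qed.

Lemma coefFP u v : (forall mu, coefF u mu = coefF v mu) -> u = v.
Proof.
move=> h; apply/ffunP => j; apply/mpolyP => a; exact: (h (a, j)).
Qed.

Lemma mcoeffXM a (p : {mpoly K[n]}) k :
  ('X_[a] * p)@_k = if (a <= k)%MM then p@_(k - a) else 0.
Proof.
rewrite -commr_mpolyX; case: ifPn => ak; first by rewrite -{1}(submK ak) addmC mcoeffMX.
apply/memN_msupp_eq0; rewrite (perm_mem (msuppMX _ _)).
by apply: contra ak => /mapP[b _ ->]; rewrite lem_addr.
Qed.

Lemma coefF_X a v mu : coefF (scaleF 'X_[a] v) mu =
  if (a <= mu.1)%MM then coefF v (mu.1 - a, mu.2)%MM else 0.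
Proof. by rewrite /coefF ffunE mcoeffXM. Qed.

Lemma coefF_mon mu nu : coefF (monF K mu) nu = (mu == nu)%:R.
Proof.
case: mu nu => [a i] [b j]; rewrite /coefF !ffunE /= xpair_eqE [i == j]eq_sym.
by case: eqP => _; rewrite ?andbF ?mulr0 ?mcoeff0 // mulr1 mcoeffX andbT.
Qed.

Lemma scaleF_D (p q : {mpoly K[n]}) v : scaleF (p + q) v = scaleF p v + scaleF q v.
Proof. by apply/ffunP => j; rewrite !ffunE mulrDl. Qed.

Lemma scaleF_C (c : K) v : scaleF c%:MP v = c *: v.
Proof. by apply/ffunP => j; rewrite !ffunE mul_mpolyC. Qed.

Lemma scaleF_A (p q : {mpoly K[n]}) v : scaleF (p * q) v = scaleF p (scaleF q v).
Proof. by apply/ffunP => j; rewrite !ffunE mulrA. Qed.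

Definition compF z v : F :=
  [ffun j => if (degE j <= z)%N then pihomog mdeg (z - degE j) (v j) else 0].

Lemma mcoeff_pihomog d (p : {mpoly K[n]}) a :
  (pihomog mdeg d p)@_a = if mdeg a == d then p@_a else 0.
Proof.
rewrite /pihomog raddf_sum big_mkcond /=.
transitivity (\sum_(b <- msupp p) if mdeg a == d then (p@_b *: 'X_[b])@_a else 0).
  apply: eq_bigr => b _; rewrite mcoeffZ mcoeffX.
  by case: (b =P a) => [->//|_]; rewrite mulr0 !if_same.
case: ifP => _; last by rewrite big1.
by rewrite -raddf_sum /= -mpolyE.
Qed.

Lemma coefF_comp z v mu :
  coefF (compF z v) mu = if mondeg degE mu == z then coefF v mu else 0.
Proof.
rewrite /coefF ffunE /mondeg; case: ifP => h; last first.
  by rewrite mcoeff0; case: eqP => // e; move: h; rewrite -e leq_addl.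
by rewrite mcoeff_pihomog -(eqn_add2r (degE mu.2)) subnK.
Qed.

Lemma compF_linear z (c : K) u v : compF z (c *: u + v) = c *: compF z u + compF z v.
Proof.
apply: coefFP => mu; rewrite !(coefFD, coefFZ, coefF_comp).
by case: ifP; rewrite ?coefFD ?coefFZ // mulr0 addr0.
Qed.

Lemma compFD z u v : compF z (u + v) = compF z u + compF z v.
Proof. by have := compF_linear z 1 u v; rewrite !scale1r. Qed.

Lemma compF0 z : compF z 0 = 0.
Proof. by apply: coefFP => mu; rewrite coefF_comp coefF0 if_same. Qed.

Lemma compFB z u v : compF z (u - v) = compF z u - compF z v.
Proof. by rewrite addrC -scaleN1r compF_linear scaleN1r addrC. Qed.

Lemma compF_sum z (I : Type) (r : seq I) (P : pred I) (G : I -> F) :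
  compF z (\sum_(i <- r | P i) G i) = \sum_(i <- r | P i) compF z (G i).
Proof.
by elim/big_rec2: _ => [|i x y _ <-]; rewrite ?compF0 // compFD.
Qed.

Lemma homog_compF z v : homogF degE z (compF z v).
Proof. by move=> mu; rewrite /in_suppF coefF_comp; case: (_ =P z) => //; rewrite eqxx. Qed.

Lemma compF_homog z e v : homogF degE e v -> compF z v = if z == e then v else 0.
Proof.
move=> hv; apply: coefFP => mu; rewrite coefF_comp.
have [c0|/hv ->] := eqVneq (coefF v mu) 0; last first.
  by rewrite eq_sym; case: ifP; rewrite ?coefF0.
by rewrite c0 if_same; case: ifP; rewrite ?c0 ?coefF0.
Qed.

(** Any larger bound is allowed, so that the sum can be made to include a prescribed degree. *)
Lemma compF_partition v :
  exists N0, forall N, (N0 <= N)%N -> v = \sum_(y < N) compF y v.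
Proof.
exists (\max_(j < m) \max_(a <- msupp (v j)) (mdeg a + degE j)).+1%N => N N0.
apply: coefFP => mu; rewrite coefF_sum.
have [c0|cn0] := eqVneq (coefF v mu) 0.
  by rewrite c0 big1 // => y _; rewrite coefF_comp c0 if_same.
have dN : (mondeg degE mu < N)%N.
  apply: leq_trans N0; rewrite ltnS /mondeg.
  apply: leq_trans (leq_bigmax mu.2).
  by apply: (@leq_bigmax_seq _ _ predT (fun a => (mdeg a + degE mu.2)%N)); rewrite // mcoeff_msupp.
rewrite (bigD1 (Ordinal dN)) //= coefF_comp eqxx big1 ?addr0 // => y yN.
by rewrite coefF_comp; case: eqP => // e; case/eqP: yN; apply: val_inj.
Qed.

Lemma subsp_homog z : subsp (homogF degE z : F -> Prop).
Proof.
split=> [mu|c u v hu hv mu]; first by rewrite /in_suppF coefF0 eqxx.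
rewrite /in_suppF coefFD coefFZ.
have [cu|/hu //] := eqVneq (coefF u mu) 0.
by rewrite cu mulr0 add0r => /hv.
Qed.

(** Graded submodules are given by closure properties rather than generators, so that sums with an
    image and preimages under graded maps stay in the class. *)
Record gsub W : Prop := Gsub {
  gsub0 : W 0;
  gsubD : forall u v, W u -> W v -> W (u + v);
  gsubZ : forall p v, W v -> W (scaleF p v);
  gsubC : forall z v, W v -> W (compF z v) }.

Lemma gsub_subsp W : gsub W -> subsp W.
Proof.
move=> gW; split; first exact: gsub0.
by move=> c u v Wu Wv; rewrite -scaleF_C; apply: gsubD => //; apply: gsubZ.
Qed.

Definition piece W z v := W v /\ homogF degE z v.

Lemma subsp_piece W z : subsp W -> subsp (piece W z).
Proof.
move=> [W0 WD]; have [H0 HD] := subsp_homog z.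
by split=> [//|c u v [Wu hu] [Wv hv]]; split; auto.
Qed.

End Graded.

Section GradedMap.
Variables (K : fieldType) (n m m' : nat) (degE : 'I_m -> nat) (degE' : 'I_m' -> nat).
Variables (phi : Fmod K n m' -> Fmod K n m) (e : nat).
Hypothesis phiD : forall u v, phi (u + v) = phi u + phi v.
Hypothesis phiZ : forall p u, phi (scaleF p u) = scaleF p (phi u).
Hypothesis phiH : forall z u, homogF degE' z u -> homogF degE (z + e) (phi u).

Lemma phiZK (c : K) u : phi (c *: u) = c *: phi u.
Proof. by rewrite -!scaleF_C phiZ. Qed.

Lemma phi0 : phi 0 = 0.
Proof. by rewrite -(scale0r 0) phiZK scale0r. Qed.

Lemma phiB u v : phi (u - v) = phi u - phi v.
Proof. by rewrite phiD -scaleN1r phiZK scaleN1r. Qed.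

Lemma phi_sum (I : Type) (r : seq I) (P : pred I) (G : I -> Fmod K n m') :
  phi (\sum_(i <- r | P i) G i) = \sum_(i <- r | P i) phi (G i).
Proof. by elim/big_rec2: _ => [|i x y _ <-]; rewrite ?phi0 // phiD. Qed.

Lemma compF_phi z u :
  compF degE z (phi u) = if (e <= z)%N then phi (compF degE' (z - e) u) else 0.
Proof.
have [N0 /(_ (maxn N0 z.+1)) {1}->] := compF_partition degE' u; last exact: leq_maxl.
rewrite phi_sum compF_sum.
under eq_bigr => y _ do rewrite (compF_homog z (phiH (@homog_compF _ _ _ degE' y u))).
case: (leqP e z) => ez; last first.
  by rewrite big1 // => y _; rewrite ifN //; lia.
have zN : (z - e < maxn N0 z.+1)%N by rewrite leq_max ltnS leq_subr orbT.
rewrite (bigD1 (Ordinal zN)) //= subnK // eqxx big1 ?addr0 // => y yN.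
rewrite ifN //; apply: contra yN => /eqP h; apply/eqP/val_inj => /=; lia.
Qed.

End GradedMap.

Section MonomialCount.
Variables (n m : nat) (degE : 'I_m -> nat).

Definition tmon z (x : 'X_{1..n < z.+1} * 'I_m) : Fmon n m := (bmnm x.1, x.2).

Definition tidx z (mu : Fmon n m) : 'X_{1..n < z.+1} * 'I_m := (bmon z mu.1, mu.2).

Lemma tidxK z mu : mondeg degE mu = z -> tmon (tidx z mu) = mu.
Proof.
case: mu => a j <-; rewrite /tmon /tidx /= bmonK //.
by rewrite /mondeg leq_addr.
Qed.

Lemma tmon_inj z : injective (@tmon z).
Proof. by move=> [a i] [b j] [/val_inj -> ->]. Qed.

Lemma card_tmon z (Q : Fmon n m -> bool) :
  #|{: {x : 'X_{1..n < z.+1} * 'I_m | (mondeg degE (tmon x) == z) && Q (tmon x)}}| =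
  (\sum_j delay (degE j) (cnt (fun a => Q (a, j))) z)%N.
Proof.
rewrite card_sig -sum1_card (partition_big (fun x => x.2) predT) //=.
apply: eq_bigr => j _; rewrite sum1_card.
transitivity #|[pred a : 'X_{1..n < z.+1} | (mdeg a + degE j == z)%N && Q (bmnm a, j)]|.
  apply: (@card_bij _ _ _ _ (fun x : 'X_{1..n < z.+1} * 'I_m => x.1)
     (fun a : 'X_{1..n < z.+1} => (a, j))).
    by move=> [a i] /andP[/= h /eqP /= <-].
  by move=> a /= h; rewrite !unfold_in /= eqxx andbT.
rewrite /delay; case: leqP => h; last first.
  by apply: eq_card0 => a; rewrite !inE; apply/negP => /andP[/eqP e _]; lia.
rewrite -(@cnt_bound _ _ _ z) ?leq_subr //; apply: eq_card => a; rewrite !inE.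
by congr (_ && _); apply/eqP/eqP; lia.
Qed.

End MonomialCount.

(** * Initial modules and division with remainder *)

Section NormalBasis.
Variables (K : fieldType) (n m : nat) (degE : 'I_m -> nat).
Variable le : rel (Fmon n m).
Hypothesis le_mon : is_monomial_order le.
Notation F := (Fmod K n m).
Implicit Types (u v w : F) (mu nu : Fmon n m) (W : F -> Prop).

Definition normal W mu := ~~ `[< in_initial le W mu >].

(** One degree contains finitely many monomials, so counting predecessors turns arguments along [le]
    into inductions on nat. *)
Definition mon_rank z mu :=
  #|[pred x : 'X_{1..n < z.+1} * 'I_m |
     [&& mondeg degE (tmon x) == z, le (tmon x) mu & tmon x != mu]]|.

Lemma mon_rank_lt z mu nu : mondeg degE mu = z -> le mu nu -> mu != nu ->
  (mon_rank z mu < mon_rank z nu)%N.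
Proof.
case: le_mon => -[le_refl le_anti le_trans _] _ dz mn neq.
apply/proper_card/properP; split.
  apply/subsetP => x; rewrite !inE => /and3P[-> xm xnm] /=.
  rewrite (le_trans _ _ _ xm mn); apply: contra neq => /eqP xn.
  by rewrite -xn; apply/eqP/le_anti; rewrite xm xn mn.
by exists (tidx z mu); rewrite !inE (tidxK dz) ?eqxx ?andbF // dz eqxx mn.
Qed.

Lemma mon_rank_inj z mu nu : mondeg degE mu = z -> mondeg degE nu = z ->
  mon_rank z mu = mon_rank z nu -> mu = nu.
Proof.
case: (le_mon) => -[_ _ _ le_total] _ dm dn e; apply/eqP; apply: contraT => neq.
have /orP[h|h] := le_total mu nu.
  by have := mon_rank_lt dm h neq; rewrite e ltnn.
by have := mon_rank_lt dn h; rewrite eq_sym e ltnn => /(_ neq).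
Qed.

Lemma lead_ex z v mu : homogF degE z v -> in_suppF v mu -> exists nu, is_lead le v nu.
Proof.
case: (le_mon) => -[le_refl _ _ le_total] _ hv vmu.
have h0 : in_suppF v (tmon (tidx z mu)) by rewrite (tidxK (hv _ vmu)).
case: (@arg_maxnP _ (tidx z mu) (fun x => in_suppF v (tmon x)) (fun x => mon_rank z (tmon x)) h0).
move=> x vx xmax; exists (tmon x); split=> // nu vnu.
have := xmax (tidx z nu); rewrite (tidxK (hv _ vnu)) => /(_ vnu) h.
have [->|neq] := eqVneq (tmon x) nu; first exact: le_refl.
have /orP[//|h'] := le_total nu (tmon x).
by have := mon_rank_lt (hv _ vx) h' neq; rewrite ltnNge => /negP[]; exact: h.
Qed.

(** [in_initial] admits inhomogeneous elements; the component in the degree of the leading monomial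
    keeps that leading monomial. *)
Lemma in_initial_piece W z mu : gsub degE W -> in_initial le W mu ->
  mondeg degE mu = z -> exists w, piece degE W z w /\ is_lead le w mu.
Proof.
case: (le_mon) => _ [le_mul _] gW [v [nu [Wv v0 [vnu lv] [a ->]]]] dz.
exists (scaleF 'X_[a] (compF degE (mondeg degE nu) v)).
have suppE mu' : in_suppF (scaleF 'X_[a] (compF degE (mondeg degE nu) v)) mu' ->
    exists nu', [/\ mu' = mulmon a nu', in_suppF v nu' & mondeg degE nu' = mondeg degE nu].
  rewrite /in_suppF coefF_X; case: ifP => [am|]; last by rewrite eqxx.
  rewrite coefF_comp; case: (_ =P mondeg _ _) => [h c|]; last by rewrite eqxx.
  exists (mu'.1 - a, mu'.2)%MM; split=> //; rewrite /mulmon /= addmC submK //.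
  by case: mu' {h c am}.
split; first split.
- by apply: (gsubZ gW); apply: (gsubC gW).
- move=> mu' /suppE [nu' [-> _ h]]; rewrite -dz /mondeg /= !mdegD -!addnA.
  by rewrite -![(mdeg _.1 + _)%N]/(mondeg degE _) h.
split; last by move=> mu' /suppE [nu' [-> /lv h _]]; apply: le_mul.
rewrite /in_suppF coefF_X /= lem_addr coefF_comp addmC addmK.
by rewrite -surjective_pairing eqxx.
Qed.

Lemma division W z v : gsub degE W -> homogF degE z v ->
  exists r, [/\ homogF degE z r, forall mu, in_suppF r mu -> normal W mu & W (v - r)].
Proof.
move=> gW; have sW := gsub_subsp gW; have sH := @subsp_homog K n m degE z.
have [N] : exists N, forall mu, in_suppF v mu -> (mon_rank z mu < N)%N.
  by exists #|{: 'X_{1..n < z.+1} * 'I_m}|.+1 => mu _; rewrite ltnS max_card.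
elim: N v => [|N IH] v vN hv.
  exists 0; split=> [|mu|]; first by case: sH.
    by rewrite /in_suppF coefF0 eqxx.
  suff -> : v = 0 by rewrite subrr; case: sW.
  apply: coefFP => mu; rewrite coefF0; apply/eqP; apply: contraT.
  by move=> /vN.
have [[mu [vmu rank_mu]]|nex] :=
  pselect (exists mu, in_suppF v mu /\ mon_rank z mu = N); last first.
  apply: IH => // mu vmu; rewrite ltn_neqAle -ltnS vN // andbT.
  by apply/eqP => e; apply: nex; exists mu.
have dmu := hv _ vmu.
(* One cancellation covers both cases: w is the monomial itself, which then goes to the remainder,
   or an element of W led by it. *)
have [w [hw wmu lw ww]] : exists w, [/\ homogF degE z w, in_suppF w mu,
    forall nu, in_suppF w nu -> le nu mu & normal W mu /\ w = monF K mu \/ W w].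
  have [nmu|] := boolP (normal W mu).
    have sw nu : in_suppF (monF K mu) nu -> nu = mu.
      by rewrite /in_suppF coefF_mon; case: (mu =P nu) => // _; rewrite eqxx.
    exists (monF K mu); split=> [nu /sw -> //||nu /sw ->|]; last by left.
      by rewrite /in_suppF coefF_mon eqxx oner_eq0.
    by case: le_mon => -[].
  rewrite negbK => /asboolP imu.
  have [w [[Ww hw] [lw1 lw2]]] := in_initial_piece gW imu dmu.
  by exists w; split=> //; right.
pose c := coefF v mu / coefF w mu.
have hv' : homogF degE z (v - c *: w) by apply: (subspB sH) => //; apply: (subspZ _ sH).
have [|r [hr nr Wr]] := IH _ _ hv'.
  move=> nu; rewrite /in_suppF coefFD coefFN coefFZ.
  have [->|neq] := eqVneq nu mu; first by rewrite /c divfK // subrr eqxx.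
  have [vnu|vnu _] := eqVneq (coefF v nu) 0.
    have [wnu|wnu _] := eqVneq (coefF w nu) 0; first by rewrite vnu wnu mulr0 subr0 eqxx.
    by rewrite -rank_mu; apply: mon_rank_lt => //; [apply: hw | apply: lw].
  rewrite ltn_neqAle -ltnS vN // andbT; apply/eqP => e.
  by move/eqP: neq; apply; apply: (@mon_rank_inj z) => //; [apply: hv | rewrite rank_mu].
case: ww => [[nmu wE]|Ww].
  exists (r + c *: w); split.
  - by apply: (subspD sH) => //; apply: (subspZ _ sH).
  - move=> nu; rewrite /in_suppF coefFD coefFZ wE coefF_mon.
    case: (mu =P nu) => [<-//|_]; rewrite mulr0 addr0; exact: nr.
  by rewrite opprD addrA -addrA [- r + _]addrC addrA.
exists r; split=> //; rewrite -[v in v - r](subrK (c *: w)) -addrA [_ - r]addrC addrA.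
by apply: (subspD sW) => //; apply: (subspZ _ sW).
Qed.

Lemma mon_expand z v (Q : pred ('X_{1..n < z.+1} * 'I_m)) : homogF degE z v ->
  (forall x, in_suppF v (tmon x) -> Q x) ->
  v = \sum_(x | Q x) coefF v (tmon x) *: monF K (tmon x).
Proof.
move=> hv Qv; apply: coefFP => mu; rewrite coefF_sum.
under eq_bigr do rewrite coefFZ coefF_mon.
have [c0|vmu] := eqVneq (coefF v mu) 0.
  rewrite c0 big1 // => x _.
  by case: (_ =P mu) => [->|_]; rewrite ?mulr0 // c0 mul0r.
have e := tidxK (hv _ vmu).
rewrite (bigD1 (tidx z mu)) /=; last by apply: Qv; rewrite e.
rewrite e eqxx mulr1 big1 ?addr0 // => x /andP[_ xn].
case: (_ =P mu) => [xm|_]; rewrite ?mulr0 //; case/eqP: xn.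
by apply: (@tmon_inj n m); rewrite e.
Qed.

Definition nidx W z :=
  {x : 'X_{1..n < z.+1} * 'I_m | (mondeg degE (tmon x) == z) && normal W (tmon x)}.

Definition nbasis W z (x : nidx W z) : F := monF K (tmon (val x)).

Lemma sum_nbasis W z (c : nidx W z -> K) (x : nidx W z) :
  coefF (\sum_i c i *: nbasis i) (tmon (val x)) = c x.
Proof.
rewrite coefF_sum (bigD1 x) //= big1 => [|y yx].
  by rewrite addr0 coefFZ coefF_mon eqxx mulr1.
rewrite coefFZ coefF_mon; case: (_ =P tmon (val x)) => [/tmon_inj/val_inj e|_].
  by rewrite e eqxx in yx.
by rewrite mulr0.
Qed.

(** Macaulay's basis theorem. [division] gives spanning; a nontrivial relation would be an element
    of W with a normal leading monomial. *)
Lemma normal_basis W z : gsub degE W ->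
  qbasis (@nbasis W z) (homogF degE z) (piece degE W z).
Proof.
move=> gW; split.
- move=> x mu; have /andP[/eqP dx _] := valP x; rewrite /nbasis /in_suppF coefF_mon.
  by case: (_ =P mu) => [<-//|_]; rewrite eqxx.
- move=> v hv; have [r [hr nr Wr]] := division gW hv.
  exists (fun x => coefF r (tmon (val x))).
  have <- : r = \sum_i coefF r (tmon (val i)) *: nbasis (i : nidx W z).
    pose Q (x : 'X_{1..n < z.+1} * 'I_m) :=
      (mondeg degE (tmon x) == z) && normal W (tmon x).
    rewrite [LHS](@mon_expand z r Q) //; last first.
      by move=> x rx; rewrite /Q hr // eqxx nr.
    by rewrite (big_sub Q).
  by split=> //; apply: (subspB (@subsp_homog _ _ _ degE z)).
move=> c [Wv hv] x; apply/eqP; apply: contraT => cx.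
set v := \sum_i _ in Wv hv.
have vx : in_suppF v (tmon (val x)) by rewrite /in_suppF sum_nbasis.
have [nu [vnu lnu]] := lead_ex hv vx.
have [y e] : exists y : nidx W z, nu = tmon (val y).
  apply: contrapT => h; move: vnu; rewrite /in_suppF coefF_sum big1 ?eqxx // => y _.
  rewrite coefFZ coefF_mon; case: (_ =P nu) => [e|_]; last by rewrite mulr0.
  by case: h; exists y.
have /andP[_ /negP[]] := valP y; rewrite -e; apply/asboolP; exists v, nu; split=> //.
  by apply: contraTneq vnu => ->; rewrite /in_suppF coefF0 eqxx.
by exists 0%MM; rewrite /mulmon add0m -surjective_pairing.
Qed.

(* The Hilbert function of F / W, read off the monomials outside in(W). *)
Definition Hf W z := (\sum_j delay (degE j) (cnt (fun a => normal W (a, j))) z)%N.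

Lemma card_nidx W z : #|{: nidx W z}| = Hf W z.
Proof. exact: card_tmon. Qed.

End NormalBasis.

(** * Additivity of Hilbert functions *)

Section ExactStep.
Variables (K : fieldType) (n m m' : nat) (degE : 'I_m -> nat) (degE' : 'I_m' -> nat).
Variables (le : rel (Fmon n m)) (le' : rel (Fmon n m')).
Hypothesis le_mon : is_monomial_order le.
Hypothesis le_mon' : is_monomial_order le'.
Variables (phi : Fmod K n m' -> Fmod K n m) (e : nat).
Hypothesis phiD : forall u v, phi (u + v) = phi u + phi v.
Hypothesis phiZ : forall p u, phi (scaleF p u) = scaleF p (phi u).
Hypothesis phiH : forall z u, homogF degE' z u -> homogF degE (z + e) (phi u).
Variable W : Fmod K n m -> Prop.
Hypothesis gW : gsub degE W.

Definition ext_by v := exists u, W (v - phi u).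
Definition pre_by u := W (phi u).

Lemma gsub_ext_by : gsub degE ext_by.
Proof.
split.
- by exists 0; rewrite (phi0 phiZ) subr0; apply: gsub0 gW.
- move=> u v [u' hu] [v' hv]; exists (u' + v').
  by rewrite phiD opprD addrACA; apply: (gsubD gW).
- move=> p v [u h]; exists (scaleF p u); rewrite phiZ.
  suff -> : scaleF p v - scaleF p (phi u) = scaleF p (v - phi u) by apply: (gsubZ gW).
  by apply/ffunP => j; rewrite !ffunE mulrBr.
move=> z v [u /(gsubC gW z)]; rewrite compFB (compF_phi phiD phiZ phiH).
case: ifP => _ h; first by exists (compF degE' (z - e) u).
by exists 0; rewrite (phi0 phiZ).
Qed.

Lemma gsub_pre_by : gsub degE' pre_by.
Proof.
split; rewrite /pre_by.
- by rewrite (phi0 phiZ); apply: gsub0 gW.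
- by move=> u v; rewrite phiD; apply: (gsubD gW).
- by move=> p v; rewrite phiZ; apply: (gsubZ gW).
move=> z v /(gsubC gW (z + e)); rewrite (compF_phi phiD phiZ phiH).
by rewrite leq_addl addnK.
Qed.

(* 0 -> (F'/pre_by)(-e) -> F/W -> F/ext_by -> 0 is exact. *)
Lemma Hf_exact z :
  Hf degE le W z = (Hf degE le ext_by z + delay e (Hf degE' le' pre_by) z)%N.
Proof.
have gE := gsub_ext_by; have gP := gsub_pre_by.
have sW := gsub_subsp gW; have sE := gsub_subsp gE.
have B := normal_basis le_mon z gW; have BE := normal_basis le_mon z gE.
have pWE v : piece degE W z v -> piece degE ext_by z v.
  by move=> [Wv hv]; split=> //; exists 0; rewrite (phi0 phiZ) subr0.
have pEH v : piece degE ext_by z v -> homogF degE z v by case.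
have sPE := subsp_piece degE z sE.
have sPW := subsp_piece degE z sW.
(* A preimage may be inhomogeneous; its component of degree z - e already suffices, and none is
   needed when z < e. *)
have comp_ext v : piece degE ext_by z v -> exists u,
    W (v - (if (e <= z)%N then phi (compF degE' (z - e) u) else 0)).
  move=> [[u Wu] hv]; move: (gsubC gW z Wu); rewrite compFB (compF_phi phiD phiZ phiH).
  by rewrite (compF_homog _ hv) eqxx => h; exists u.
rewrite -!card_nidx /delay; case: (leqP e z) => ez.
  rewrite -card_nidx -card_sum.
  apply: (qbasis_card sPW B); apply: (qbasis_trans sPE pEH pWE BE).
  have [Bh Bs Bf] := normal_basis le_mon' (z - e) gP.
  have phB (u : Fmod K n m') : homogF degE' (z - e) u -> homogF degE z (phi u).
    by move=> /phiH; rewrite subnK.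
  have sH := @subsp_homog K n m degE z; have sH' := @subsp_homog K n m' degE' (z - e).
  have phiS (c : nidx degE' le' pre_by (z - e) -> K) :
      \sum_i c i *: phi (nbasis i) = phi (\sum_i c i *: nbasis i).
    by rewrite (phi_sum phiD phiZ); apply: eq_bigr => i _; rewrite (phiZK phiZ).
  have hS (c : nidx degE' le' pre_by (z - e) -> K) :
      homogF degE' (z - e) (\sum_i c i *: nbasis i).
    by apply: (subsp_sum _ sH') => // i _; apply: (subspZ _ sH'); apply: Bh.
  split=> [i|w Ww|c].
  - split; last by apply: phB; apply: Bh.
    by exists (nbasis i); rewrite subrr; apply: gsub0 gW.
  - have [u] := comp_ext w Ww; rewrite ez => Wu.
    have [c [Wc _]] := Bs _ (@homog_compF _ _ _ degE' (z - e) u).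
    exists c; rewrite phiS; split.
      move: Wc; rewrite /pre_by (phiB phiD phiZ) => /(subspD sW Wu).
      by rewrite addrA subrK.
    by apply: (subspB sH); [case: Ww | apply: phB].
  rewrite phiS => -[Wc _]; apply: Bf; split=> //.
(* Below degree [e] the image of [phi] has no component, so one basis serves both quotients. *)
rewrite addn0; apply: (qbasis_card sPW B).
suff BE' : qbasis (@nbasis K n m degE le ext_by z) (homogF degE z) (piece degE W z) by exact: BE'.
case: BE => Eh Es Ef; split=> // [w /Es[c Wc]|c /pWE /Ef //].
exists c; split; last by case: Wc.
by have [u] := comp_ext _ Wc; rewrite leqNgt ez /= subr0.
Qed.

End ExactStep.

(** * Cone decompositions *)

Section Multiple.
Variables (K : fieldType) (n m : nat) (degE : 'I_m -> nat) (h : Fmod K n m).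

(* S is viewed as the free module of rank 1. *)
Definition mulF (u : Fmod K n 1) : Fmod K n m := scaleF (u ord0) h.

Lemma mulF_D u v : mulF (u + v) = mulF u + mulF v.
Proof. by rewrite /mulF ffunE scaleF_D. Qed.

Lemma mulF_Z p u : mulF (scaleF p u) = scaleF p (mulF u).
Proof. by rewrite /mulF ffunE scaleF_A. Qed.

Variable e : nat.
Hypothesis hh : homogF degE e h.

Lemma homog_scaleX a : homogF degE (mdeg a + e) (scaleF 'X_[a] h).
Proof.
move=> mu; rewrite /in_suppF coefF_X; case: ifP => [am /hh <-|]; last by rewrite eqxx.
by rewrite /mondeg /= addnA -mdegD addmC submK.
Qed.

Lemma scaleF_sum (I : Type) (r : seq I) (P : pred I) (G : I -> {mpoly K[n]}) (v : Fmod K n m) :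
  scaleF (\sum_(i <- r | P i) G i) v = \sum_(i <- r | P i) scaleF (G i) v.
Proof.
apply/ffunP => j; rewrite !ffunE sum_ffunE mulr_suml.
by apply: eq_bigr => i _; rewrite ffunE.
Qed.

Lemma scaleF_scale (c : K) p (v : Fmod K n m) : scaleF (c *: p) v = c *: scaleF p v.
Proof. by rewrite -mul_mpolyC scaleF_A scaleF_C. Qed.

Lemma homog_scale d (p : {mpoly K[n]}) : homogS d p -> homogF degE (d + e) (scaleF p h).
Proof.
move=> hp; rewrite [p]mpolyE scaleF_sum big_seq.
apply: (subsp_sum _ (@subsp_homog _ _ _ degE (d + e))) => a.
rewrite mcoeff_msupp => /hp <-; rewrite scaleF_scale.
by apply: (subspZ _ (@subsp_homog _ _ _ degE _)); apply: homog_scaleX.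
Qed.

Lemma mulF_H z u : homogF (fun=> 0%N) z u -> homogF degE (z + e) (mulF u).
Proof.
move=> hu; apply: homog_scale => a /(hu (a, ord0)).
by rewrite /mondeg addn0.
Qed.

Lemma compF_scale z p : compF degE z (scaleF p h) =
  if (e <= z)%N then scaleF (pihomog mdeg (z - e) p) h else 0.
Proof.
have := compF_phi mulF_D mulF_Z mulF_H z [ffun=> p].
by rewrite /mulF !ffunE subn0.
Qed.

End Multiple.

Lemma big_swap_pair (V : nmodType) (I J : finType) (R : pred (I * J)) (G : I * J -> V) :
  \sum_(x | R x) G x = \sum_j \sum_(i | R (i, j)) G (i, j).
Proof.
rewrite [RHS](exchange_big_dep predT) //= pair_big_dep /=.
by apply: eq_big => [[i j]|[i j] _].
Qed.

Section ConeCount.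
Variables (K : fieldType) (n m : nat) (degE : 'I_m -> nat).
Variables (T : Fmod K n m -> Prop) (k : nat) (P : 'I_k -> cone K n m).
Variable Q : Fmon n m -> bool.
Hypothesis TQ : forall v, T v <-> forall nu, in_suppF v nu -> Q nu.
Hypothesis PT : cone_decomp degE T P.

Definition zeroF (v : Fmod K n m) := v = 0.

Lemma subsp_zero : subsp zeroF.
Proof. by split=> // c u v -> ->; rewrite scaler0 addr0. Qed.

Lemma subsp_span : subsp T.
Proof.
split; first by apply/TQ => nu; rewrite /in_suppF coefF0 eqxx.
move=> c u v /TQ Tu /TQ Tv; apply/TQ => nu; rewrite /in_suppF coefFD coefFZ.
have [u0|/Tu //] := eqVneq (coefF u nu) 0.
by rewrite u0 mulr0 add0r => /Tv.
Qed.

Lemma mon_qbasis z :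
  qbasis (fun x : {x : 'X_{1..n < z.+1} * 'I_m | (mondeg degE (tmon x) == z) && Q (tmon x)} =>
    monF K (tmon (val x))) (piece degE T z) zeroF.
Proof.
split.
- move=> x; have /andP[/eqP dx Qx] := valP x; split.
    by apply/TQ => nu; rewrite /in_suppF coefF_mon; case: (_ =P nu) => [<-|_] //; rewrite eqxx.
  by move=> nu; rewrite /in_suppF coefF_mon; case: (_ =P nu) => [<-|_] //; rewrite eqxx.
- move=> v [/TQ Tv hv]; exists (fun x => coefF v (tmon (val x))).
  pose R (x : 'X_{1..n < z.+1} * 'I_m) := (mondeg degE (tmon x) == z) && Q (tmon x).
  rewrite /zeroF [X in X - _](@mon_expand K n m degE z v R) //; last first.
    by move=> x vx; rewrite /R hv // eqxx Tv.
  by rewrite (big_sub R) subrr.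
move=> c c0 x; rewrite -(coefF0 K (tmon (val x))) -c0 coefF_sum (bigD1 x) //= big1 => [|y yx].
  by rewrite addr0 coefFZ coefF_mon eqxx mulr1.
rewrite coefFZ coefF_mon; case: (_ =P tmon (val x)) => [/tmon_inj/val_inj e|_].
  by rewrite e eqxx in yx.
by rewrite mulr0.
Qed.

Notation pdeg := (fun i => cdeg degE (P i)).
Notation R z := (fun x : 'X_{1..n < z.+1} * 'I_k =>
  (mondeg pdeg (tmon x) == z) && supp_in (P x.2).2 (bmnm x.1)).

Lemma cone_gen_neq0 i : (P i).1 != 0. Proof. by case: PT => /(_ i) []. Qed.

Lemma cone_gen_homog i : homogF degE (cdeg degE (P i)) (P i).1.
Proof. by case: PT => /(_ i) []. Qed.

Lemma cone_scale i p : (forall a, p@_a != 0 -> supp_in (P i).2 a) ->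
  in_cone (P i) (scaleF p (P i).1).
Proof.
move=> hp; exists p; split=> // a /hp /forallP h j ju.
by apply/eqP; apply: (implyP (h j)).
Qed.

Lemma cone_span i v : in_cone (P i) v -> T v.
Proof.
move=> iv; case: PT => _ hT _; apply/hT.
exists (fun j => if j == i then v else 0); split=> [j|].
  case: eqP => [->//|_]; exists 0; split=> [a|]; first by rewrite mcoeff0 eqxx.
  by apply/ffunP => l; rewrite !ffunE mul0r.
by rewrite -big_mkcond big_pred1_eq.
Qed.

(** Independence: directness reduces a relation to a single cone, where p h = 0 with h nonzero
    forces p = 0 because S is a domain. *)
Lemma cone_qbasis z : qbasis (fun x : {x : 'X_{1..n < z.+1} * 'I_k | R z x} =>
    scaleF 'X_[bmnm (val x).1] (P (val x).2).1) (piece degE T z) zeroF.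
Proof.
have sT := subsp_span; case: PT => _ hT dT; split.
- move=> x; have /andP[/eqP dx sx] := valP x; split.
    apply: (@cone_span (val x).2); apply: cone_scale => a; rewrite mcoeffX.
    by case: (_ =P a) => [<-//|_]; rewrite eqxx.
  have := @homog_scaleX _ _ _ _ _ _ (@cone_gen_homog (val x).2) (bmnm (val x).1).
  by rewrite -[(_ + _)%N]/(mondeg pdeg (tmon (val x))) dx.
- move=> v [/hT [c [/choice [p pP] vE]] hv].
  exists (fun x => (p (val x).2)@_(bmnm (val x).1)).
  rewrite /zeroF -(big_sub (R z) (fun x : 'X_{1..n < z.+1} * 'I_k =>
     (p x.2)@_(bmnm x.1) *: scaleF 'X_[bmnm x.1] (P x.2).1)).
  apply/eqP; rewrite subr_eq0; apply/eqP.
  (* The summands in the cones need not be homogeneous; passing to degree z throughout repairs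
     this. *)
  have <- : compF degE z v = v by rewrite (compF_homog _ hv) eqxx.
  rewrite vE compF_sum big_swap_pair /=; apply: eq_bigr => i _.
  have [pi ->] := pP i; rewrite (compF_scale (@cone_gen_homog i)).
  under [RHS]eq_bigr do rewrite -scaleF_scale.
  rewrite -scaleF_sum; case: leqP => h; last first.
    rewrite big1 => [|a /andP[/eqP da _]]; last by move: da; rewrite /mondeg /= => da; exfalso; lia.
    by apply/ffunP => j; rewrite !ffunE mul0r.
  congr scaleF; apply/mpolyP => b; rewrite mcoeff_pihomog raddf_sum /=.
  under eq_bigr do rewrite mcoeffZ mcoeffX.
  have [pb|pb] := eqVneq (p i)@_b 0.
    rewrite pb if_same big1 // => a _.
    by case: (bmnm a =P b) => [->|_]; rewrite ?pb ?mul0r ?mulr0.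
  have sb : supp_in (P i).2 b.
    by apply/forallP => j; apply/implyP => ju; apply/eqP; apply: pi.
  case: eqP => db; last first.
    rewrite big1 // => a /andP[/eqP da _]; case: (bmnm a =P b) => [ab|_]; last by rewrite mulr0.
    by case: db; rewrite -ab; move: da; rewrite /mondeg /=; lia.
  have eb : bmnm (bmon z b) = b by rewrite bmonK // db leq_subr.
  rewrite (bigD1 (bmon z b)) /=; last by rewrite unfold_in /mondeg /= eb db sb subnK // eqxx.
  rewrite eb eqxx mulr1 big1 ?addr0 // => a /andP[_ /eqP ab].
  by case: (bmnm a =P b) => [e|_]; rewrite ?mulr0 //; case: ab; apply: val_inj; rewrite /= e.
move=> c c0 x0; pose c' x := oapp c 0 (insub x).
have cE y : c y = c' (val y) by rewrite /c' valK.
move: c0; under eq_bigr do rewrite cE.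
rewrite -(big_sub (R z) (fun x : 'X_{1..n < z.+1} * 'I_k =>
     c' x *: scaleF 'X_[bmnm x.1] (P x.2).1)) big_swap_pair /=.
under eq_bigr => i _ do under eq_bigr do rewrite -scaleF_scale.
under eq_bigr do rewrite -scaleF_sum.
move=> /dT h; have {h} h i : \sum_(a | R z (a, i)) c' (a, i) *: 'X_[bmnm a] = 0.
  have : scaleF (\sum_(a | R z (a, i)) c' (a, i) *: 'X_[bmnm a]) (P i).1 = 0.
    apply: h => {}i; apply: cone_scale => b; rewrite raddf_sum /= => nz.
    apply: contraNT nz => sb; rewrite big1 // => a /andP[_ sa].
    rewrite mcoeffZ mcoeffX; case: (bmnm a =P b) => [e|_]; last by rewrite mulr0.
    by rewrite -e sa in sb.
  move=> /ffunP s0; have /eqP/ffunP nz := cone_gen_neq0 i.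
  have [j Pj] : exists j, (P i).1 j != 0.
    apply: contrapT => hn; apply: nz => j; rewrite ffunE; apply/eqP; apply: contraT => pj.
    by case: hn; exists j.
  by have := s0 j; rewrite !ffunE => /eqP; rewrite mulf_eq0 (negbTE Pj) orbF => /eqP.
rewrite cE; have := valP x0; case: (val x0) => a i Rx.
have := congr1 (fun p => p@_(bmnm a)) (h i); rewrite mcoeff0 raddf_sum /=.
rewrite (bigD1 a) //= mcoeffZ mcoeffX eqxx mulr1 big1 ?addr0 // => b /andP[_ ba].
rewrite mcoeffZ mcoeffX; case: (bmnm b =P bmnm a) => [/val_inj e|_]; last by rewrite mulr0.
by rewrite e eqxx in ba.
Qed.

(** Each graded piece of T has two bases, its monomials and the monomial multiples of the cone
    generators. [card_tmon] counts both, the cones playing the role of basis vectors of a free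
    module of rank k. *)
Lemma cone_decomp_hasnum :
  hasnum n (fun z => \sum_j delay (degE j) (cnt (fun a => Q (a, j))) z)%N
           (hnum n [seq (cdeg degE (P i), cdim (P i)) | i <- enum 'I_k]).
Proof.
rewrite /hnum big_map big_enum /=.
apply: (@hasnum_ext n (fun z => \sum_i delay (cdeg degE (P i)) (cnt (supp_in (P i).2)) z)%N).
  move=> z; rewrite -(card_tmon degE z) -(card_tmon pdeg z (fun mu => supp_in (P mu.2).2 mu.1)).
  exact: (qbasis_card subsp_zero (cone_qbasis z) (mon_qbasis z)).
apply: hasnum_sum => i; apply: hasnum_delay.
rewrite -[Ym ^+ _]mulr1; apply: hasnum_raise; last exact: cnt_supp_in.
by rewrite -[X in (_ <= X)%N]card_ord max_card.
Qed.

End ConeCount.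

(** * Filtrations by generators *)

Section Chain.
Variables (K : fieldType) (n m m' k : nat) (degE : 'I_m -> nat) (degE' : 'I_m' -> nat).
Variables (phi : 'I_k -> Fmod K n m' -> Fmod K n m) (e : 'I_k -> nat).
Hypothesis phiD : forall i u v, phi i (u + v) = phi i u + phi i v.
Hypothesis phiZ : forall i p u, phi i (scaleF p u) = scaleF p (phi i u).
Hypothesis phiH : forall i z u, homogF degE' z u -> homogF degE (z + e i) (phi i u).
Variable W0 : Fmod K n m -> Prop.
Hypothesis gW0 : gsub degE W0.

(** W0 enlarged by the images of the first t maps. Keeping [phi] abstract covers multiplication by
    g_i on F as well as the maps from S to F sending 1 to f_t. *)
Definition chain t v := exists c : 'I_k -> Fmod K n m',
  W0 (v - \sum_(i < k | (i < t)%N) phi i (c i)).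

Lemma chain0 : chain 0 = W0.
Proof.
apply/funext => v; apply/propext; split=> [[c]|W0v].
  by rewrite big_pred0 // subr0.
by exists (fun=> 0); rewrite big_pred0 // subr0.
Qed.

Lemma chainS (i : 'I_k) : chain i.+1 = ext_by (phi i) (chain i).
Proof.
have pE (j : 'I_k) : ((j < i.+1)%N && (j != i)) = (j < i)%N.
  by rewrite -val_eqE /= ltnS ltn_neqAle andbC.
apply/funext => v; apply/propext; split=> [[c]|[u [c]]] h.
  exists (c i), c; move: h; rewrite (bigD1 i) //= opprD addrA.
  by under eq_bigl do rewrite pE.
exists (fun j => if j == i then u else c j).
rewrite (bigD1 i) //= eqxx opprD addrA.
rewrite (eq_bigl (fun j : 'I_k => (j < i)%N)) //.
rewrite (eq_bigr (fun j => phi j (c j))) // => j ji.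
by rewrite ifN //; apply: contraTneq ji => ->; rewrite ltnn.
Qed.

Lemma gsub_chain t : (t <= k)%N -> gsub degE (chain t).
Proof.
elim: t => [|t IH] tk; first by rewrite chain0.
rewrite -[t]/(val (Ordinal tk)) chainS.
apply: (gsub_ext_by (phiD _) (phiZ _) (@phiH _)); exact: (IH (ltnW tk)).
Qed.

Variables (le : rel (Fmon n m)) (le' : rel (Fmon n m')).
Hypothesis le_mon : is_monomial_order le.
Hypothesis le_mon' : is_monomial_order le'.

Lemma Hf_chainS (i : 'I_k) z : Hf degE le (chain i) z =
  (Hf degE le (chain i.+1) z +
   delay (e i) (Hf degE' le' (pre_by (phi i) (chain i))) z)%N.
Proof.
rewrite chainS.
apply: (Hf_exact le_mon le_mon' (phiD i) (phiZ i) (@phiH i)).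
exact: gsub_chain (ltnW _).
Qed.

End Chain.

(** * Hilbert series of complete intersections *)

Section BasicHilbert.
Variables (n : nat).

Lemma cnt_all : hasnum n (cnt (fun _ : 'X_{1..n} => true)) 1.
Proof.
have := @cnt_supp_in n setT; rewrite cardsT card_ord.
by apply: hasnum_ext => z; apply: cnt_ext => a _; apply/forallP => i; rewrite inE.
Qed.

(** A new bound on one variable removes the multiples of x_i^(d_i); by injectivity of [iota] the
    other bounds ignore that variable, so the removed part is the old box delayed by d_i. *)
Lemma cnt_box k (iota : 'I_k -> 'I_n) (d : 'I_k -> nat) (s : seq 'I_k) :
  injective iota -> uniq s ->
  hasnum n (cnt (fun a => all (fun i => a (iota i) < d i)%N s))
         (\prod_(i <- s) (1 - 'X^(d i))).
Proof.
move=> iota_inj; elim: s => [_|i s IH /= /andP[iNs us]].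
  by rewrite big_nil; apply: cnt_all.
rewrite big_cons mulrBl mul1r.
apply: (@hasnum_addr _ (delay (d i) (cnt (fun a => all (fun i => a (iota i) < d i)%N s)))
   _ (cnt (fun a => all (fun i => a (iota i) < d i)%N s))); last 2 first.
- exact: IH.
- by apply: hasnum_delay; apply: IH.
move=> z; rewrite (cnt_split _ (iota i) (d i)) addnC; congr (_ + _)%N.
  apply: delay_ext => y; apply: cnt_ext => a _; apply: eq_in_all => j js.
  rewrite mnmDE mulmnE mnm1E (inj_eq iota_inj).
  by case: (i =P j) => [ij|_]; [rewrite ij js in iNs | rewrite addn0].
by apply: cnt_ext => a _; rewrite andbC.
Qed.

(** Colon ideals live in S, viewed as a free module of rank 1, and need a monomial order of their
    own. *)
Definition le1 (mu nu : Fmon n 1) := (mu.1 <= nu.1)%O.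

Lemma le1_mon : is_monomial_order le1.
Proof.
split; first split.
- by move=> mu; rewrite /le1 lexx.
- by move=> [a i] [b j] /le_anti /= ->; rewrite [i]ord1 [j]ord1.
- by move=> mu nu rho; apply: le_trans.
- by move=> mu nu; apply: le_total.
by split=> [a mu nu|a mu]; rewrite /le1 /= ?lemc_add2r ?lemc_addl.
Qed.

End BasicHilbert.

Lemma upset_initial (K : fieldType) n m (le : rel (Fmon n m)) (W : Fmod K n m -> Prop) j :
  upset (fun a => `[< in_initial le W (a, j) >]).
Proof.
move=> a b /asboolP [v [mu [Wv v0 lv [c h]]]]; apply/asboolP; exists v, mu; split=> //.
by case: h => -> ->; exists (b + c)%MM; rewrite /mulmon /= addmA.
Qed.

Section Generators.
Variables (K : fieldType) (n m : nat) (degE : 'I_m -> nat) (le : rel (Fmon n m)).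
Hypothesis le_mon : is_monomial_order le.

Lemma gsub_zero : gsub degE (@zeroF K n m).
Proof.
split=> // [u v -> ->|p v ->|z v ->]; rewrite /zeroF ?addr0 ?compF0 //.
by apply/ffunP => j; rewrite !ffunE mulr0.
Qed.

Lemma Hf_zero : hasnum n (Hf degE le (@zeroF K n m)) (\sum_j 'X^(degE j)).
Proof.
apply: hasnum_sum => j; rewrite -['X^_]mulr1; apply: hasnum_delay.
apply: hasnum_ext (cnt_all n) => z; apply: cnt_ext => a _; apply/esym.
by apply/negP => /asboolP [v [mu [-> /eqP]]].
Qed.

Section Regular.
Variables (k : nat) (g : 'I_k -> {mpoly K[n]}) (d : 'I_k -> nat).
Hypothesis gd : forall i, homogS (d i) (g i).
Hypothesis g_reg : regular_seq g.

Notation gphi := (fun (i : 'I_k) (u : Fmod K n m) => scaleF (g i) u).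

Lemma gphiD i (u v : Fmod K n m) : gphi i (u + v) = gphi i u + gphi i v.
Proof. by apply/ffunP => j; rewrite !ffunE mulrDr. Qed.

Lemma gphiZ i p (u : Fmod K n m) : gphi i (scaleF p u) = scaleF p (gphi i u).
Proof. by rewrite -!scaleF_A mulrC. Qed.

Lemma gphiH i z (u : Fmod K n m) : homogF degE z u -> homogF degE (z + d i) (gphi i u).
Proof. by move=> hu; rewrite addnC; apply: homog_scale. Qed.

Definition gchain := chain gphi (@zeroF K n m).

Lemma in_ideal_sub (R : pred 'I_k) p :
  in_ideal (fun i : {i | R i} => g (sval i)) p <->
  exists c : 'I_k -> {mpoly K[n]}, p = \sum_(i | R i) g i * c i.
Proof.
split=> [[c ->]|[c ->]].
  exists (fun i => oapp c 0 (insub i)).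
  rewrite (big_sub R (fun i => g i * oapp c 0 (insub i))).
  by apply: eq_bigr => i _; rewrite valK mulrC.
exists (fun i => c (val i)); rewrite (big_sub R (fun i => g i * c i)).
by apply: eq_bigr => i _; rewrite mulrC.
Qed.

Lemma gchainP t v : gchain t v <->
  forall j, exists c : 'I_k -> {mpoly K[n]}, v j = \sum_(i < k | (i < t)%N) g i * c i.
Proof.
split=> [[c /eqP]|/choice [c cE]].
  rewrite subr_eq0 => /eqP -> j; exists (fun i => c i j).
  by rewrite sum_ffunE; apply: eq_bigr => i _; rewrite ffunE.
exists (fun i => [ffun j => c j i]); apply/eqP; rewrite subr_eq0; apply/eqP.
apply/ffunP => j; rewrite cE sum_ffunE; apply: eq_bigr => i _.
by rewrite !ffunE.
Qed.

(** Regularity enters here: g_i is injective modulo its predecessors, so the kernel term of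
    [Hf_exact] is the module one started from. The series H then satisfies H = H' + X^(d_i) H,
    giving a factor 1 - X^(d_i). *)
Lemma pre_gchain (i : 'I_k) : pre_by (gphi i) (gchain i) = gchain i.
Proof.
apply/funext => v; apply/propext; split; last first.
  by apply: (gsubZ (gsub_chain gphiD gphiZ gphiH gsub_zero (ltnW (ltn_ord i)))).
move=> /gchainP h; apply/gchainP => j; apply/in_ideal_sub; apply: g_reg.1.
by apply/in_ideal_sub; have := h j; rewrite ffunE.
Qed.

Lemma Hf_gchain t : (t <= k)%N -> hasnum n (Hf degE le (gchain t))
  ((\sum_j 'X^(degE j)) * \prod_(i < k | (i < t)%N) (1 - 'X^(d i))).
Proof.
elim: t => [|t IH] tk.
  by rewrite [X in _ * X]big_pred0 // mulr1 /gchain chain0; apply: Hf_zero.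
have tk' := IH (ltnW tk); set i := Ordinal tk.
rewrite [X in _ * X](bigD1 i) //=.
rewrite [X in _ * (_ * X)](eq_bigl (fun j : 'I_k => (j < t)%N)); last first.
  by move=> j; rewrite -val_eqE /= ltnS ltn_neqAle andbC.
rewrite mulrCA mulrBl mul1r.
apply: (hasnum_addr _ tk' (hasnum_delay (d i) tk')) => z.
have := Hf_chainS gphiD gphiZ gphiH gsub_zero le_mon le_mon i z.
by rewrite -/gchain pre_gchain addnC.
Qed.

End Regular.

Lemma Hf_fchain (W0 : Fmod K n m -> Prop) p D s (f : 'I_s -> Fmod K n m) :
  gsub degE W0 -> hasnum n (Hf degE le W0) p ->
  (forall t, homogF degE (degF degE (f t)) (f t)) ->
  (forall t, (degF degE (f t) <= D)%N) ->
  forall t, (t <= s)%N -> exists B, [/\ nstandard D B, dimle n B &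
    hasnum n (Hf degE le (chain (fun i => mulF (f i)) W0 t)) (p - hnum n B)].
Proof.
move=> gW0 W0p fh fD; elim=> [|t IH] ts.
  by exists [::]; split=> //; rewrite chain0 /hnum big_nil subr0.
have [B [stB dB nB]] := IH (ltnW ts); set i := Ordinal ts.
pose V := pre_by (mulF (f i)) (chain (fun i => mulF (f i)) W0 t).
have [A [nA stA dA]] := staircase (@upset_initial K n 1 (@le1 n) V ord0).
(* The shifted family is standard only from deg f_i on; D bounds all these degrees, so every layer
   can be raised to D. *)
have [|||A' [stA' dA' hA' _]] := @raise_standard n (degF degE (f i)) D (shift (degF degE (f i)) A).
- exact: fD.
- by have := nstandard_shift (d := degF degE (f i)) stA; rewrite addn0.
- exact: dimle_shift.
exists (A' ++ B); split; [exact: nstandard_cat|exact: dimle_cat|].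
rewrite hnum_cat hA' hnum_shift opprD addrCA addrC.
apply: (hasnum_addr _ nB (hasnum_delay (degF degE (f i)) nA)) => z.
have := Hf_chainS (fun j => mulF_D (f j)) (fun j => mulF_Z (f j))
  (fun j => @mulF_H K n m degE (f j) _ (@fh j)) gW0 le_mon (@le1_mon n) i z.
move=> ->; rewrite addnC; congr (_ + _)%N; apply: delay_ext => y.
by rewrite /Hf big_ord1 /delay subn0.
Qed.

End Generators.

(** * Numerators of the two decompositions *)

Section Assembly.
Variables (K : fieldType) (n m : nat) (degE : 'I_m -> nat).

Definition cone_types k (P : 'I_k -> cone K n m) :=
  [seq (cdeg degE (P i), cdim (P i)) | i <- enum 'I_k].

Lemma cone_typesP k (P : 'I_k -> cone K n m) x :
  x \in cone_types P -> exists i, x = (cdeg degE (P i), cdim (P i)).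
Proof. by move=> /mapP[i _ ->]; exists i. Qed.

Lemma mem_cone_types k (P : 'I_k -> cone K n m) i :
  (cdeg degE (P i), cdim (P i)) \in cone_types P.
Proof. by apply/mapP; exists i; rewrite // mem_enum. Qed.

Lemma dimle_cone_types k (P : 'I_k -> cone K n m) : dimle n (cone_types P).
Proof.
by move=> x /cone_typesP[i ->]; rewrite -[X in (_ <= X)%N]card_ord max_card.
Qed.

Lemma nstandard_cone_types q k (P : 'I_k -> cone K n m) :
  q_standard degE q P -> nstandard q (cone_types P).
Proof.
move=> [h1 h2] x /cone_typesP[i ->] /= i0; split; first exact: h1.
move=> e /h2 [//|j [<- dj]]; exists (cdim (P j)) => //; exact: mem_cone_types.
Qed.

(** Exactness separates degrees only in positive dimension, so cones of dimension 0 are dropped at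
    the price of a congruence. *)
Lemma pos_cone_types q k (P : 'I_k -> cone K n m) : q_exact degE q P ->
  let P' := [seq x <- cone_types P | (0 < x.2)%N] in
  [/\ nstandard q P', uniq (map fst P') & congY n (hnum n (cone_types P)) (hnum n P')].
Proof.
move=> [/nstandard_cone_types stP exP] P'; split.
- move=> x; rewrite mem_filter => /andP[x0 xP] _; have [qx h] := stP x xP x0.
  split=> // e /h [j xj ej]; exists j => //.
  by rewrite mem_filter ej andbT (leq_trans x0).
- rewrite /P' filter_map -map_comp map_inj_in_uniq; first exact: filter_uniq (enum_uniq _).
  move=> i j; rewrite !mem_filter /= => /andP[i0 _] /andP[j0 _] ij.
  by apply/eqP; apply: contraT => nij; have := exP i j nij i0 j0; rewrite ij eqxx.
exists (\sum_(x <- cone_types P | ~~ (0 < x.2)%N) 'X^(x.1)).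
rewrite /hnum big_filter (bigID (fun x : nat * nat => (0 < x.2)%N)) /= mulr_sumr.
congr (_ + _); apply: eq_bigr => x; rewrite -eqn0Ngt => /eqP ->.
by rewrite subn0 mulrC.
Qed.

Lemma genJF_mon r (d : 'I_(n - r) -> nat) (nu : Fmon n m) :
  in_submod (@genJF K n m r d) (monF K nu) <->
  exists i, (d i <= nu.1 (widen_ord (leq_subr r n) i))%N.
Proof.
pose w := widen_ord (leq_subr r n).
have XE i : 'X_(w i) ^+ d i = 'X_[U_(w i) *+ d i] :> {mpoly K[n]}.
  by rewrite mpolyXn.
have div i (a : 'X_{1..n}) : (U_(w i) *+ d i <= a)%MM = (d i <= a (w i))%N.
  apply/mnm_lepP/idP => [/(_ (w i))|h j].
    by rewrite mulmnE mnm1E eqxx mul1n.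
  by rewrite mulmnE mnm1E; case: (w i =P j) => [<-|]; rewrite ?mul1n.
split=> [[c E]|[i di]].
  have := coefF_mon K nu nu; rewrite eqxx => /eqP; rewrite {1}E coefF_sum => nz.
  apply: contrapT => nex; move: nz; rewrite big1 ?[0 == 1]eq_sym ?oner_eq0 // => -[i j] _.
  rewrite /genJF /= -scaleF_A XE mulrC scaleF_A coefF_X div.
  by case: ifP => // di; case: nex; exists i.
exists (fun x => if x == (i, nu.2) then 'X_[nu.1 - U_(w i) *+ d i] else 0).
rewrite (bigD1 (i, nu.2)) //= eqxx big1 => [|x /negbTE ->].
  by rewrite addr0 /genJF /= -scaleF_A XE -mpolyXD submK // div.
by apply/ffunP => j; rewrite !ffunE mul0r.
Qed.

Lemma JF_normal r (d : 'I_(n - r) -> nat) (Q := fun nu : Fmon n m =>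
    all (fun i => nu.1 (widen_ord (leq_subr r n) i) < d i)%N (enum 'I_(n - r))) v :
  Nmonomial (in_submod (@genJF K n m r d)) v <->
  forall nu, in_suppF v nu -> Q nu.
Proof.
have QE nu : Q nu <-> ~ in_submod (@genJF K n m r d) (monF K nu).
  split=> [/allP h /genJF_mon [i]|h].
    by rewrite leqNgt h ?mem_enum.
  apply/allP => i _; rewrite ltnNge; apply/negP => di.
  by apply: h; apply/genJF_mon; exists i.
by split=> h nu /h /QE.
Qed.

(** The size is the degree plus one: this is the origin of the + 1 in the second term of the bound,
    and the - n comes from the factor (1 - X)^n of cones of dimension 0. *)
Lemma size_regular_num k (d : 'I_k -> nat) :
  (size ((\sum_j 'X^(degE j)) * \prod_i (1 - 'X^(d i)) : {poly int})%R <=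
    \sum_i d i + l_max degE + 1)%N.
Proof.
have s1 : (size (\sum_j 'X^(degE j) : {poly int})%R <= (l_max degE).+1)%N.
  apply: (leq_trans (size_sum _ _ _)); apply/bigmax_leqP => j _.
  by rewrite size_polyXn ltnS /l_max leq_bigmax.
have s2 : (size (\prod_i (1 - 'X^(d i)) : {poly int})%R <= (\sum_i d i).+1)%N.
  elim/big_rec2: _ => [|i a p _ IH]; first by rewrite size_poly1.
  apply: (leq_trans (size_polyMleq _ _)).
  have : (size (1 - 'X^(d i) : {poly int})%R <= (d i).+1)%N.
    by rewrite (leq_trans (size_polyD _ _)) // size_polyN size_polyXn size_poly1 geq_max leqnn.
  by move: IH; lia.
apply: (leq_trans (size_polyMleq _ _)); move: s1 s2.
by move: (size _) (size _) => a b; lia.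
Qed.

Lemma gsub_mem_comp (W : Fmod K n m -> Prop) v :
  gsub degE W -> (forall z, W (compF degE z v)) -> W v.
Proof.
move=> gW h; have [N /(_ N (leqnn N)) ->] := compF_partition degE v.
by apply: (subsp_sum _ (gsub_subsp gW)) => z _; apply: h.
Qed.

Lemma sum_genM r (g : 'I_(n - r) -> {mpoly K[n]}) s (f : 'I_s -> Fmod K n m) c :
  \sum_x scaleF (c x) (genM g f x) =
  [ffun j => \sum_i g i * c (inl (i, j))] + \sum_t scaleF (c (inr t)) (f t).
Proof.
rewrite big_sumType /=; congr (_ + _); apply/ffunP => j.
rewrite ffunE sum_ffunE.
transitivity (\sum_i \sum_j' scaleF (c (inl (i, j'))) (scaleF (g i) (basisF K n j')) j).
  by rewrite pair_bigA; apply: eq_bigr => -[i j'].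
apply: eq_bigr => i _; rewrite (bigD1 j) //= big1 => [|j' j'j].
  by rewrite addr0 !ffunE eqxx mulr1 mulrC.
by rewrite !ffunE eq_sym (negbTE j'j) !mulr0.
Qed.

Lemma sum_ltn_ord (V : nmodType) k (G : 'I_k -> V) :
  \sum_(i < k | (i < k)%N) G i = \sum_i G i.
Proof. by apply: eq_bigl => i; apply: ltn_ord. Qed.

Lemma genM_chain r (g : 'I_(n - r) -> {mpoly K[n]}) s (f : 'I_s -> Fmod K n m) :
  in_submod (genM g f) = chain (fun i => mulF (f i)) (gchain (m := m) g (n - r)) s.
Proof.
apply/funext => v; apply/propext; split=> [[c]|[c /gchainP h]].
  rewrite sum_genM => ->; exists (fun t => [ffun=> c (inr t)]); apply/gchainP => j.
  exists (fun i => c (inl (i, j))).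
  have -> : \sum_(t < s | (t < s)%N) mulF (f t) [ffun=> c (inr t)] =
      \sum_t scaleF (c (inr t)) (f t).
    by rewrite sum_ltn_ord; apply: eq_bigr => t _; rewrite /mulF ffunE.
  by rewrite sum_ltn_ord addrK ffunE.
have [c' cE] := choice h.
exists (fun x => match x with inl ij => c' ij.2 ij.1 | inr t => c t ord0 end).
rewrite sum_genM -[LHS](subrK (\sum_(i < s | (i < s)%N) mulF (f i) (c i))).
congr (_ + _); last by rewrite sum_ltn_ord.
by apply/ffunP => j; rewrite [RHS]ffunE -[RHS]sum_ltn_ord; apply: cE.
Qed.

End Assembly.

Theorem theorem6p4 (K : fieldType) (n m : nat) (degE : 'I_m -> nat)
  (le : rel (Fmon n m)) (r : nat) (g : 'I_(n - r) -> {mpoly K[n]})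
  (d : 'I_(n - r) -> nat) (s : nat) (f : 'I_s -> Fmod K n m)
  (kq : nat) (Q : 'I_kq -> cone K n m) (kp : nat) (P : 'I_kp -> cone K n m) :
  (r <= n)%N ->
  is_monomial_order le ->
  (forall i, homogS (d i) (g i)) ->
  regular_seq g ->
  (0 < s)%N ->
  (forall t, f t != 0 /\ homogF degE (degF degE (f t)) (f t)) ->
  let D := (\max_(t < s) degF degE (f t))%N in
  (l_max degE <= D)%N ->
  let M := in_submod (genM g f) in
  (exists v, ~ M v) ->
  let JF := in_submod (@genJF K n m r d) in
  cone_decomp degE (NM le M) Q -> q_standard degE (l_max degE) Q ->
  cone_decomp degE (Nmonomial JF) P -> q_exact degE D P ->
  ((cdeg_max degE Q).+1 <=
     maxn (macaulay_b degE D P 1) ((\sum_i d i + l_max degE + 1) - n))%N.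
Proof.
move=> rn le_mon gd g_reg s0 fh D lD M [v0 nMv0] JF QM Qst PJ Pex.
have gW0 : gsub degE (gchain (m := m) g (n - r)).
  exact: (gsub_chain (@gphiD K n m _ g) (@gphiZ K n m _ g)
    (@gphiH K n m degE _ g d gd) (@gsub_zero K n m degE) (leqnn _)).
have fh' t := (fh t).2.
have fD t : (degF degE (f t) <= D)%N by apply: (leq_bigmax t).
have gM : gsub degE M.
  rewrite /M genM_chain; apply: (gsub_chain (fun j => mulF_D (f j)) (fun j => mulF_Z (f j))
    (fun j => @mulF_H K n m degE (f j) _ (@fh' j)) gW0 (leqnn _)).
pose C : {poly int} := (\sum_j 'X^(degE j)) * \prod_i (1 - 'X^(d i)).
have nC : hasnum n (Hf degE le (gchain (m := m) g (n - r))) C.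
  suff -> : C = (\sum_j 'X^(degE j)) * \prod_(i < n - r | (i < n - r)%N) (1 - 'X^(d i)).
    exact: (@Hf_gchain K n m degE le le_mon _ g d gd g_reg _ (leqnn (n - r))).
  by congr (_ * _); apply: eq_bigl => i; rewrite ltn_ord.
have [B [stB dB]] := Hf_fchain le_mon gW0 nC fh' fD (leqnn s).
rewrite -genM_chain -/M => nB.
have TQ v : NM le M v <-> forall nu, in_suppF v nu -> normal le M nu.
  by split=> h nu /h; [move=> ?; apply/negP => /asboolP|move=> /negP nn /asboolP].
have nQ := cone_decomp_hasnum TQ QM.
have hQ : hnum n (cone_types degE Q) = C - hnum n B by apply: hasnum_inj nQ nB.
have nP := cone_decomp_hasnum (@JF_normal K n m r d) PJ.
have hP : hnum n (cone_types degE P) = C.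
  apply: (hasnum_inj nP).
  (* Over each e_j the monomials outside [JF] form a box. *)
  rewrite /C mulr_suml; apply: hasnum_sum => j; apply: hasnum_delay.
  have := @cnt_box n _ (widen_ord (leq_subr r n)) d (enum 'I_(n - r)).
  rewrite big_enum /=; apply; last exact: enum_uniq.
  by move=> i i' /(congr1 val) /= e; apply: val_inj.
have [A [stA dA hA memA]] := raise_standard lD (nstandard_cone_types Qst)
  (@dimle_cone_types K n m degE kq Q).
have [stP uP cP] := pos_cone_types Pex.
set P' := [seq _ <- _ | _] in stP uP cP.
have stAB : nstandard D (A ++ B) by apply: nstandard_cat.
have dAB : dimle n (A ++ B) by apply: dimle_cat.
have hAB : hnum n (A ++ B) = C by rewrite hnum_cat hA hQ subrK.
have posb y : y \in A ++ B -> (0 < y.2)%N -> (y.1 < macaulay_b degE D P 1)%N.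
  move=> yAB y0.
  have [|||y' y'P yy'] := standard_exact_deg stAB stP dAB _ uP _ _ yAB y0.
  - by move=> x; rewrite mem_filter => /andP[_]; apply: dimle_cone_types.
  - by move=> x; rewrite mem_filter => /andP[].
  - by rewrite hAB -hP.
  apply: leq_ltn_trans yy' _; move: y'P; rewrite mem_filter => /andP[y'0].
  move=> /cone_typesP[i y'E]; rewrite /macaulay_b leq_max; apply/orP; right.
  rewrite y'E in y'0 *.
  exact: (@leq_bigmax_cond _ (fun i => 0 < cdim (P i))%N (fun i => (cdeg degE (P i)).+1) i).
(* Since M is proper, [Q] is nonempty and its maximal degree is attained: without cones N_M is zero
   and division puts every component of v0 into M. *)
have [i0 _] : exists i : 'I_kq, true.
  apply: contrapT => nQ0; apply: nMv0; apply: (gsub_mem_comp gM) => z.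
  have [t [_ nt Mt]] := division le_mon gM (@homog_compF K n m degE z v0).
  have : NM le M t by apply/TQ.
  case: QM => _ hT _ /hT [c [_ tE]]; move: Mt; rewrite tE big1 ?subr0 // => i _.
  by case: nQ0; exists i.
rewrite /cdeg_max; have [|i ->] := @bigop.eq_bigmax _ (fun i => cdeg degE (Q i)).
  by apply/card_gt0P; exists i0.
have iQ := mem_cone_types degE Q i.
have [di|di] := posnP (cdim (Q i)).
  have iA : (cdeg degE (Q i), cdim (Q i)) \in A ++ B.
    by rewrite mem_cat memA //= di.
  apply: (deg_dim0 posb _ iA di).
  by rewrite hAB; apply: size_regular_num.
rewrite leq_max; apply/orP; left.
(* Raising may have split a cone of degree below D, but b_1 is at least D by definition. *)
have [iD|iD] := leqP D (cdeg degE (Q i)).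
  apply: (posb (cdeg degE (Q i), cdim (Q i))) => //.
  by rewrite mem_cat memA //= iD orbT.
by apply: leq_trans iD _; rewrite /macaulay_b leq_maxl.
Qed.
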